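(* Let $x^*$ be a stationary point of the problem $\min\{f(x): h(x)=0,\ g(x)\in K\}$ with Lagrange multiplier $(\lambda^*,\mu^* )\in\mathcal{M}(x^* )$, and suppose that Assumption A and Assumption B (both stated in the context) hold at $x^*$. If $c>0$ is sufficiently large, then there exists a constant $\delta>0$ such that, whenever $(\lambda^0,\mu^0)\in\mathbb{B}_\delta(\lambda^*,\mu^* )$, the whole sequence $\{(\lambda^k,\mu^k)\}$ generated by the second-order method of multipliers (described in the context) with penalty parameter $c$ is well-defined and converges to $(\lambda^*,\mu^* )$ with a superlinear convergence rate, i.e., $\|(\lambda^{k+1},\mu^{k+1})-(\lambda^*,\mu^* )\|=o(\|(\lambda^k,\mu^k)-(\lambda^*,\mu^* )\|)$ as $k\to\infty$.
   Context: Setting. $\mathcal{X},\mathcal{Z}$ are finite-dimensional real Hilbert spaces; $f:\mathcal{X}\to\mathbb{R}$, $h:\mathcal{X}\to\mathbb{R}^m$, $g:\mathcal{X}\to\mathcal{Z}$ are twice continuously differentiable; $K\subseteq\mathcal{Z}$ is a closed convex self-dual cone, i.e. $K=\{\mu:\langle\mu,\mu'\rangle\ge0\ \forall\mu'\in K\}$; $\Pi_K$ is the metric projection onto $K$. $\mathbb{B}_r(u)$ is the open ball of radius $r$ around $u$. $\mathcal{J}$ denotes the Fréchet derivative and $\nabla$ its adjoint; $\mathbb{L}(\mathcal{Z},\mathcal{Z})$ is the space of linear operators on $\mathcal{Z}$, and $\mathcal{I}_{\mathcal{Z}}$ the identity. For a locally Lipschitz $F$ on an open set, differentiable on $D_F$,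 the Bouligand subdifferential is $\partial_BF(u)=\{\lim_k\mathcal{J}F(u^k): u^k\in D_F,\ u^k\to u\}$ and Clarke's generalized Jacobian $\partial F(u)$ is its convex hull. $F$ is semismooth at $u$ if it is directionally differentiable at $u$ and $F(u^k)-F(u)-V^k(u^k-u)=o(\|u^k-u\|)$ for all $u^k\to u$, $V^k\in\partial F(u^k)$; it is strongly semismooth if $o(\|u^k-u\|)$ can be replaced by $O(\|u^k-u\|^2)$. Standing assumption: $\Pi_K$ is strongly semismooth (everywhere on $\mathcal{Z}$). Lagrangian: $\mathcal{L}_0(x,\lambda,\mu)=f(x)-\langle\lambda,h(x)\rangle-\langle\mu,g(x)\rangle$. Augmented Lagrangian ($c>0$): $\mathcal{L}_c(x,\lambda,\mu)=f(x)-\langle\lambda,h(x)\rangle+\frac c2\|h(x)\|^2+\frac1{2c}(\|\Pi_K(\mu-cg(x))\|^2-\|\mu\|^2)$. $\mathcal{M}(x)$ is the set of $(\lambda,\mu)\in\mathbb{R}^m\times\mathcal{Z}$ satisfying the KKT system $\nabla_x\mathcal{L}_0(x,\lambda,\mu)=0$, $h(x)=0$, $g(x)\in K$, $\mu\in K$, $\langle\mu,g(x)\rangle=0$; $x$ is stationary if $\mathcal{M}(x)\ne\emptyset$. For $W\in\mathbb{L}(\mathcal{Z},\mathcal{Z})$ let $\mathcal{A}_{(c,\lambda^*,\mu^* )}(W)=\nabla^2_{xx}\mathcal{L}_0(x^*,\lambda^*,\mu^* )+c\nabla h(x^* )\mathcal{J}h(x^* )+c\nabla g(x^* )W\mathcal{J}g(x^*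 )$. Assumption A: (i) $(\lambda^*,\mu^* )$ is the unique element of $\mathcal{M}(x^* )$; (ii) there exist constants $\bar c>0,\eta>0$ such that for any $c\ge\bar c$, $\langle x,\mathcal{A}_{(c,\lambda^*,\mu^* )}(W)x\rangle\ge\eta\|x\|^2$ for all $W\in\partial_B\Pi_K(\mu^*-cg(x^* ))$ and all $x\in\mathcal{X}$. Under Assumption A, for fixed $c\ge\bar c$, it is known that there exist $\varepsilon>0$, $\delta_0>0$ (depending on $c$) and a locally Lipschitz function $\mathbf{x}_c$ on $\mathbb{B}_{\delta_0}(\lambda^*,\mu^* )$, $\mathbf{x}_c(\lambda,\mu)=\arg\min_{x\in\mathbb{B}_\varepsilon(x^* )}\mathcal{L}_c(x,\lambda,\mu)$, such that: (a) $\mathbf{x}_c$ is semismooth at every point of $\mathbb{B}_{\delta_0}(\lambda^*,\mu^* )$; (b) for all $x\in\mathbb{B}_\varepsilon(x^* )$, $(\lambda,\mu)\in\mathbb{B}_{\delta_0}(\lambda^*,\mu^* )$, the $x$-component of every element of $\partial_B(\nabla_x\mathcal{L}_c)(x,\lambda,\mu)$ is positive definite; (c) $\mathbf{x}_c(\lambda,\mu)$ is the unique minimizer of $\mathcal{L}_c(\cdot,\lambda,\mu)$ over $\mathbb{B}_\varepsilon(x^* )$. Such $\varepsilon,\delta_0$ are fixed. Set $\vartheta_c(\lambda,\mu)=\min_{x\in\mathbb{B}_\varepsilon(x^* )}\mathcal{L}_c(x,\lambda,\mu)$ on $\mathbb{B}_{\delta_0}(\lambda^*,\mu^* )$; it is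 concave and continuously differentiable with $\nabla\vartheta_c(\lambda,\mu)=\big(-h(\mathbf{x}_c(\lambda,\mu)),\ \frac1c\Pi_K(\mu-cg(\mathbf{x}_c(\lambda,\mu)))-\frac{\mu}{c}\big)$, and $\nabla\vartheta_c$ is semismooth. For $(\lambda,\mu)\in\mathbb{B}_{\delta_0}(\lambda^*,\mu^* )$, writing $x=\mathbf{x}_c(\lambda,\mu)$, let $\lambda_c(\lambda,\mu)=\lambda-ch(x)$, $\mu_c(\lambda,\mu)=\Pi_K(\mu-cg(x))$, $$\mathcal{A}_c(\lambda,\mu,W)=\nabla^2_{xx}\mathcal{L}_0(x,\lambda_c(\lambda,\mu),\mu_c(\lambda,\mu))+c\nabla h(x)\mathcal{J}h(x)+c\nabla g(x)W\mathcal{J}g(x),$$ $$\mathbb{V}_c(\lambda,\mu)=\Big\{-\begin{pmatrix}\mathcal{J}h(x)\\ W\mathcal{J}g(x)\end{pmatrix}\mathcal{A}_c(\lambda,\mu,W)^{-1}\big(\nabla h(x),\nabla g(x)W\big)-\begin{pmatrix}0&0\\0&\frac1c(\mathcal{I}_{\mathcal{Z}}-W)\end{pmatrix}: W\in\partial_B\Pi_K(\mu-cg(x))\Big\},$$ a set of linear operators on $\mathbb{R}^m\times\mathcal{Z}$. Assumption B: for any $c\ge\bar c$ (with $\bar c$ from Assumption A), every $V\in\mathbb{V}_c(\lambda^*,\mu^* )$ satisfies $V\prec0$ (negative definite). Second-order method of multipliers: given $c>0$ and $(\lambda^0,\mu^0)\in\mathbb{R}^m\times\mathcal{Z}$, for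 $k=0,1,\dots$: (1) compute $x^{k+1}=\mathbf{x}_c(\lambda^k,\mu^k)$; (2) choose any $V^k\in\mathbb{V}_c(\lambda^k,\mu^k)$ and solve $\nabla\vartheta_c(\lambda^k,\mu^k)+V^k\Delta y=0$ to obtain $\Delta y^{k+1}\in\mathbb{R}^m\times\mathcal{Z}$; (3) set $(\lambda^{k+1},\mu^{k+1})=(\lambda^k,\mu^k)+\Delta y^{k+1}$. *)

(* Defs.v *)
From HB Require Import structures.
From mathcomp Require Import all_boot all_order all_algebra.
From mathcomp Require Import all_classical all_reals all_analysis.
From mathcomp Require Import ring lra.
Set Implicit Arguments.
Unset Strict Implicit.
Unset Printing Implicit Defensive.
Import Order.TTheory GRing.Theory Num.Theory.
Import numFieldNormedType.Exports.
Local Open Scope classical_set_scope.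
Local Open Scope ring_scope.

HB.mixin Record NormedVector_isHilbert (R : realType) V
    of NormedModule R V & Vector R V := {
  inner : V -> V -> R ;
  innerC : forall x y, inner x y = inner y x ;
  innerPl : forall a x y z,
    inner (a *: x + y) z = a * inner x z + inner y z ;
  normr_inner : forall x, `|x| ^+ 2 = inner x x }.

#[short(type="hilbertType")]
HB.structure Definition Hilbert (R : realType) :=
  { V of NormedModule R V & Vector R V & NormedVector_isHilbert R V }.

HB.factory Record Vector_isHilbert (R : realType) V of Vector R V := {
  dotp : V -> V -> R ;
  dotpC : forall x y, dotp x y = dotp y x ;
  dotpPl : forall a x y z, dotp (a *: x + y) z = a * dotp x z + dotp y z ;
  dotp_ge0 : forall x, 0 <= dotp x x ;
  dotp_eq0 : forall x, dotp x x = 0 -> x = 0 }.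

HB.builders Context R V of Vector_isHilbert R V.

Let nrm (x : V) : R := Num.sqrt (dotp x x).

Let dotpDl x y z : dotp (x + y) z = dotp x z + dotp y z.
Proof. by have := dotpPl 1 x y z; rewrite scale1r mul1r. Qed.

Let dotp0l z : dotp 0 z = 0.
Proof. by apply: (@addrI R (dotp 0 z)); rewrite -dotpDl !addr0. Qed.

Let dotpZl a x z : dotp (a *: x) z = a * dotp x z.
Proof. by have := dotpPl a x 0 z; rewrite !addr0 dotp0l addr0. Qed.

Let dotpDr x y z : dotp x (y + z) = dotp x y + dotp x z.
Proof. by rewrite dotpC dotpDl !(dotpC x). Qed.

Let dotpZr a x z : dotp x (a *: z) = a * dotp x z.
Proof. by rewrite dotpC dotpZl (dotpC x). Qed.

Let cauchy_schwarz x y : dotp x y <= nrm x * nrm y.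
Proof.
have [y0|yN0] := eqVneq (dotp y y) 0.
  by rewrite (dotp_eq0 y0) dotpC dotp0l mulr_ge0// sqrtr_ge0.
have yy0 : 0 < dotp y y by rewrite lt0r yN0 dotp_ge0.
rewrite /nrm -sqrtrM ?dotp_ge0//; apply: (le_trans (ler_norm _)).
rewrite -sqrtr_sqr ler_sqrt ?mulr_ge0 ?dotp_ge0//.
rewrite -subr_ge0 -(pmulr_rge0 _ yy0).
have := dotp_ge0 (dotp y y *: x + (- dotp x y) *: y).
rewrite !dotpDl !dotpDr !dotpZl !dotpZr (dotpC y x) => /le_trans; apply.
by rewrite le_eqVlt; apply/orP; left; apply/eqP; ring.
Qed.

Let ler_nrmD x y : nrm (x + y) <= nrm x + nrm y.
Proof.
rewrite -(@ger0_norm _ (nrm x + nrm y)) ?addr_ge0 ?sqrtr_ge0//.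
rewrite -sqrtr_sqr ler_sqrt ?sqr_ge0// sqrrD !sqr_sqrtr ?dotp_ge0//.
rewrite !dotpDl !dotpDr (dotpC y x).
by have := cauchy_schwarz x y; lra.
Qed.

Let nrmZ a x : nrm (a *: x) = `|a| * nrm x.
Proof. by rewrite /nrm dotpZl dotpZr mulrA sqrtrM ?sqr_ge0// -expr2 sqrtr_sqr. Qed.

Let nrm0_eq0 x : nrm x = 0 -> x = 0.
Proof.
move=> /eqP; rewrite sqrtr_eq0 => x0; apply: dotp_eq0.
by apply/eqP; rewrite eq_le x0 dotp_ge0.
Qed.

HB.instance Definition _ := Lmodule_isNormed.Build R V ler_nrmD nrmZ nrm0_eq0.

Let nrm_dotp (x : V) : `|x| ^+ 2 = dotp x x.
Proof. by rewrite sqr_sqrtr ?dotp_ge0. Qed.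

HB.instance Definition _ :=
  NormedVector_isHilbert.Build R V dotpC dotpPl nrm_dotp.

HB.end.

(* R itself, as a one-dimensional Hilbert space, so that derivatives, adjoints
   and gradients of real-valued functions are instances of the general ones. *)
Section RegularHilbert.
Context (R : realType).

Fact regular_innerPl (a x y z : R^o) :
  (a *: x + y : R^o) * z = a * (x * z) + y * z.
Proof. by rewrite mulrDl mulrA. Qed.

Fact regular_normr_inner (x : R^o) : `|x| ^+ 2 = (x : R) * x.
Proof. by rewrite -normrX ger0_norm ?sqr_ge0 ?expr2. Qed.

HB.instance Definition _ := NormedVector_isHilbert.Build R R^o
  (fun x y => mulrC (x : R) y) regular_innerPl regular_normr_inner.

End RegularHilbert.

(* The norms that the library puts on row vectors and on pairs are maximum
   norms; the two aliases below carry the Hilbert norms instead. *)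
Definition euclid (R : realType) (m : nat) : Type := 'rV[R]_m.

Section EuclidHilbert.
Context (R : realType) (m : nat).

HB.instance Definition _ := Vector.copy (euclid R m) 'rV[R]_m.

Definition euclid_dot (x y : euclid R m) : R := \sum_(i < m) x 0 i * y 0 i.

Fact euclid_dotC x y : euclid_dot x y = euclid_dot y x.
Proof. by apply: eq_bigr => i _; rewrite mulrC. Qed.

Fact euclid_dotPl a x y z :
  euclid_dot (a *: x + y) z = a * euclid_dot x z + euclid_dot y z.
Proof.
rewrite /euclid_dot mulr_sumr -big_split; apply: eq_bigr => i _ /=.
by rewrite !mxE mulrDl mulrA.
Qed.

Fact euclid_dot_ge0 x : 0 <= euclid_dot x x.
Proof. by apply: sumr_ge0 => i _; rewrite -expr2 sqr_ge0. Qed.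

Fact euclid_dot_eq0 x : euclid_dot x x = 0 -> x = 0.
Proof.
move=> /eqP; rewrite psumr_eq0; last by move=> i _; rewrite -expr2 sqr_ge0.
move=> /allP x0; apply/rowP => i; have := x0 i (mem_index_enum i).
by rewrite mxE /= mulf_eq0 orbb => /eqP.
Qed.

HB.instance Definition _ := Vector_isHilbert.Build R (euclid R m)
  euclid_dotC euclid_dotPl euclid_dot_ge0 euclid_dot_eq0.

End EuclidHilbert.

Definition hprod (R : realType) (U V : hilbertType R) : Type := (U * V)%type.

Section HprodHilbert.
Context (R : realType) (U V : hilbertType R).

HB.instance Definition _ := Vector.copy (hprod U V) (U * V)%type.

Definition hprod_dot (x y : hprod U V) : R :=
  inner x.1 y.1 + inner x.2 y.2.

Fact hprod_dotC x y : hprod_dot x y = hprod_dot y x.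
Proof. by rewrite /hprod_dot innerC (innerC x.2). Qed.

Fact hprod_dotPl a x y z :
  hprod_dot (a *: x + y) z = a * hprod_dot x z + hprod_dot y z.
Proof. by rewrite /hprod_dot /= !innerPl mulrDr addrACA. Qed.

Fact hprod_dot_ge0 x : 0 <= hprod_dot x x.
Proof. by rewrite /hprod_dot -!normr_inner addr_ge0// sqr_ge0. Qed.

Fact hprod_dot_eq0 x : hprod_dot x x = 0 -> x = 0.
Proof.
move=> /eqP; rewrite /hprod_dot -!normr_inner paddr_eq0 ?sqr_ge0//.
rewrite !expf_eq0 /= !normr_eq0 => /andP[/eqP x1 /eqP x2].
by rewrite [x]surjective_pairing x1 x2.
Qed.

HB.instance Definition _ := Vector_isHilbert.Build R (hprod U V)
  hprod_dotC hprod_dotPl hprod_dot_ge0 hprod_dot_eq0.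

End HprodHilbert.

Section BlockOperators.
Context {R : realType} {U V1 V2 : hilbertType R}.

Definition col_op (A : 'Hom(U, V1)) (B : 'Hom(U, V2)) : 'Hom(U, hprod V1 V2) :=
  linfun (fun u => (A u, B u) : hprod V1 V2).

Definition row_op (A : 'Hom(V1, U)) (B : 'Hom(V2, U)) : 'Hom(hprod V1 V2, U) :=
  linfun (fun y : hprod V1 V2 => A y.1 + B y.2).

Lemma col_opE A B u : col_op A B u = (A u, B u).
Proof.
pose F u : hprod V1 V2 := (A u, B u).
have Flin : linear F.
  by move=> a x y; rewrite /F !linearP.
pose F' : {linear U -> hprod V1 V2} :=
  HB.pack F (GRing.isLinear.Build _ _ _ _ F Flin).
exact: (lfunE F').
Qed.

Lemma row_opE A B y : row_op A B y = A y.1 + B y.2.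
Proof.
pose F (y : hprod V1 V2) : U := A y.1 + B y.2.
have Flin : linear F.
  by move=> a x z; rewrite /F /= !linearP /= scalerDr addrACA.
pose F' : {linear hprod V1 V2 -> U} :=
  HB.pack F (GRing.isLinear.Build _ _ _ _ F Flin).
exact: (lfunE F').
Qed.

End BlockOperators.

Section Calculus.
Context {R : realType}.
Implicit Types U V : hilbertType R.

Definition jac U V (F : U -> V) (u : U) : 'Hom(U, V) := linfun ('d F u).

(* The library's 'Hom(U, V) comes without a norm: this is convergence of
   A t to B along F in operator norm. *)
Definition op_cvg U V T (F : set_system T) (A : T -> 'Hom(U, V))
    (B : 'Hom(U, V)) : Prop :=
  forall e : R, 0 < e ->
    \forall t \near F, forall v, `|A t v - B v| <= e * `|v|.

Definition C1 U V (F : U -> V) : Prop :=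
  forall u, differentiable F u /\ op_cvg (nbhs u) (jac F) (jac F u).

(* As 'Hom(U, V) is finite-dimensional, jac F is continuously differentiable
   iff its evaluation at every v is. *)
Definition C2 U V (F : U -> V) : Prop :=
  C1 F /\ forall v, C1 (fun u => jac F u v).

Definition adjoint U V (A : 'Hom(U, V)) : 'Hom(V, U) :=
  xget 0 [set B : 'Hom(V, U) | forall u v, inner (A u) v = inner u (B v)].

Definition grad U (phi : U -> R^o) (u : U) : U :=
  adjoint (jac phi u) (1 : R^o).

Definition posdef U (A : 'End(U)) : Prop :=
  forall u, u != 0 -> 0 < inner u (A u).

Definition negdef U (A : 'End(U)) : Prop :=
  forall u, u != 0 -> inner u (A u) < 0.

(* Only the values of F near u matter, so a function given on an open set may
   be extended arbitrarily to the whole space. *)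
Definition Bsubdiff U V (F : U -> V) (u : U) : set 'Hom(U, V) :=
  [set A | exists uk : nat -> U,
    [/\ forall k, differentiable F (uk k), uk @ \oo --> u &
        op_cvg \oo (fun k => jac F (uk k)) A]].

Definition conv_hull U V (S : set 'Hom(U, V)) : set 'Hom(U, V) :=
  [set A | exists n (t : 'I_n -> R) (B : 'I_n -> 'Hom(U, V)),
    [/\ forall i, 0 <= t i, \sum_(i < n) t i = 1, forall i, S (B i) &
        A = \sum_(i < n) t i *: B i]].

Definition clarke U V (F : U -> V) (u : U) : set 'Hom(U, V) :=
  conv_hull (Bsubdiff F u).

Definition dir_differentiable U V (F : U -> V) (u : U) : Prop :=
  forall v, cvg ((fun t : R => t^-1 *: (F (u + t *: v) - F u)) @ 0^'+).

Definition semismooth U V (F : U -> V) (u : U) : Prop :=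
  dir_differentiable F u /\
  forall (uk : nat -> U) (Vk : nat -> 'Hom(U, V)),
    uk @ \oo --> u -> (forall k, clarke F (uk k) (Vk k)) ->
    (fun k => F (uk k) - F u - Vk k (uk k - u)) =o_\oo (fun k => uk k - u).

Definition strongly_semismooth U V (F : U -> V) (u : U) : Prop :=
  semismooth F u /\
  forall (uk : nat -> U) (Vk : nat -> 'Hom(U, V)),
    uk @ \oo --> u -> (forall k, clarke F (uk k) (Vk k)) ->
    (fun k => F (uk k) - F u - Vk k (uk k - u))
      =O_\oo (fun k => `|uk k - u| ^+ 2 : R^o).

Definition metric_proj U (K : set U) (u : U) : U :=
  xget 0 [set p | K p /\ forall q, K q -> `|u - p| <= `|u - q|].

(* A self-dual set is automatically a closed convex cone. *)
Definition self_dual U (K : set U) : Prop :=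
  K = [set mu | forall mu', K mu' -> 0 <= inner mu mu'].

End Calculus.

Section AugmentedLagrangian.
Context {R : realType} {X Z : hilbertType R} {m : nat}.
Variables (f : X -> R) (h : X -> euclid R m) (g : X -> Z) (K : set Z).

Local Notation Y := (hprod (euclid R m) Z).
Local Notation PiK := (metric_proj K).
Implicit Types (x : X) (y : Y) (c : R).

Definition lagrangian x y : R :=
  f x - inner y.1 (h x) - inner y.2 (g x).

Definition grad_lagrangian x y : X := grad (fun x' => lagrangian x' y) x.

Definition auglag c x y : R :=
  f x - inner y.1 (h x) + c / 2 * `|h x| ^+ 2
  + (2 * c)^-1 * (`|PiK (y.2 - c *: g x)| ^+ 2 - `|y.2| ^+ 2).

Definition grad_auglag c x y : X := grad (fun x' => auglag c x' y) x.

Definition multipliers x : set Y :=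
  [set y | [/\ grad_lagrangian x y = 0, h x = 0, K (g x), K y.2 &
               inner y.2 (g x) = 0]].

Definition calA c x y (W : 'End(Z)) : 'End(X) :=
  jac (fun x' => grad_lagrangian x' y) x
  + c *: (adjoint (jac h x) \o jac h x)%VF
  + c *: (adjoint (jac g x) \o W \o jac g x)%VF.

Definition assumptionA x y cbar eta : Prop :=
  multipliers x = [set y] /\
  forall c, cbar <= c -> forall W, Bsubdiff PiK (y.2 - c *: g x) W ->
    forall d, eta * `|d| ^+ 2 <= inner d (calA c x y W d).

(* eps, delta0 and xc are as in the local existence result for the primal
   minimizers: xc maps the delta0-ball around ys to the minimizers of
   auglag c over the eps-ball around xs. *)
Definition primal_minimizers c (xs : X) (ys : Y) (eps delta0 : R)
    (xc : Y -> X) : Prop :=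
  [/\ 0 < eps /\ 0 < delta0,
      [locally [lipschitz xc y | y in ball ys delta0]],
      forall y, ball ys delta0 y -> semismooth xc y,
      forall x y, ball xs eps x -> ball ys delta0 y ->
        forall V : 'Hom(hprod X Y, X),
          Bsubdiff (fun p : hprod X Y => grad_auglag c p.1 p.2) (x, y) V ->
          posdef (V \o col_op \1 0)%VF &
      forall y, ball ys delta0 y ->
        ball xs eps (xc y) /\
        forall x, ball xs eps x -> x != xc y ->
          auglag c (xc y) y < auglag c x y].

Definition dual_fun c (xs : X) (eps : R) y : R :=
  inf [set auglag c x y | x in ball xs eps].

Section Iteration.
Variables (c : R) (xc : Y -> X).

Definition lambda_c y : euclid R m := y.1 - c *: h (xc y).

Definition mu_c y : Z := PiK (y.2 - c *: g (xc y)).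

Definition calA_c y (W : 'End(Z)) : 'End(X) :=
  calA c (xc y) (lambda_c y, mu_c y) W.

Definition calV_c y : set 'End(Y) :=
  [set V | exists2 W, Bsubdiff PiK (y.2 - c *: g (xc y)) W &
    V = - (col_op (jac h (xc y)) (W \o jac g (xc y))
           \o (calA_c y W)^-1
           \o row_op (adjoint (jac h (xc y))) (adjoint (jac g (xc y)) \o W))%VF
        - col_op (row_op 0 0) (row_op 0 (c^-1 *: (\1%VF - W)))].

Variables (xs : X) (ys : Y) (eps delta0 : R).

(* y' is obtained from y by one iteration, for some admissible choice of the
   operator and some solution of the linear system. *)
Definition smm_step y y' : Prop :=
  ball ys delta0 y /\
  exists2 V, calV_c y V &
    exists2 dy, grad (dual_fun c xs eps) y + V dy = 0 & y' = y + dy.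

(* An iteration can be performed from y, whatever operator is chosen: y lies
   in the domain of xc, the gradient of the dual function exists, every
   inverse in the definition of calV_c is a true inverse, calV_c y is nonempty
   and each linear system has exactly one solution. *)
Definition smm_step_well_defined y : Prop :=
  [/\ ball ys delta0 y,
      differentiable (dual_fun c xs eps : Y -> R^o) y,
      forall W, Bsubdiff PiK (y.2 - c *: g (xc y)) W ->
        lker (calA_c y W) = 0%VS,
      calV_c y !=set0 &
      forall V, calV_c y V ->
        exists! dy, grad (dual_fun c xs eps) y + V dy = 0].

End Iteration.

Definition assumptionB (ys : Y) cbar (xc : R -> Y -> X) : Prop :=
  forall c, cbar <= c -> forall V, calV_c c (xc c) ys V -> negdef V.

End AugmentedLagrangian.

(* Main.v *)
(* Write G(x, y) for the x-gradient of the augmented Lagrangian. Any W in the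
   Bouligand subdifferential of the projection turns the semismooth expansion
   of the projection into one of G: its increment is A(W) dx - B(W) dy up to a
   negligible error, with A(W) positive definite. Hence G increases strictly
   along segments, so the critical point xs is the minimizer xc ys. Moreover,
   since G(xc y, y) = 0, xc y - xs = A(W)^-1 B(W) (y - ys) + o(|y - ys|).
   Substituting in Danskin's formula for the dual gradient yields
   grad theta(y) = V (y - ys) + o(|y - ys|) for the operator V of the method,
   and a Newton step from y lands at distance o(|y - ys|) of ys because the
   inverses of V stay bounded near ys. Uniformity in W comes from compactness,
   used through ultrafilters: along an ultrafilter W converges to an element of
   the subdifferential at ys.

   That the subdifferential is nonempty does not need Rademacher's theorem: the
   projection is directionally differentiable everywhere, and a Baire category
   argument on the difference quotients gives a dense set of points of
   differentiability. *)

Require Import Defs.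
From HB Require Import structures.
From mathcomp Require Import all_boot all_order all_algebra.
From mathcomp Require Import all_classical all_reals all_analysis.
From mathcomp Require Import ring lra.
Set Implicit Arguments.
Unset Strict Implicit.
Unset Printing Implicit Defensive.
Import Order.TTheory GRing.Theory Num.Theory.
Import numFieldNormedType.Exports.
Local Open Scope classical_set_scope.
Local Open Scope ring_scope.

(** * Finite-dimensional Hilbert spaces *)

(** The obstacle is that the projection is not differentiable and that generalized derivatives obey
    no exact chain rule in general. [diff_along] removes it: along an ultrafilter one fixed [W0]
    acts as the derivative of the projection, the ordinary rules of calculus apply to composites,
    and the operator of the method comes out as a plain composite derivative. The identity of
    [xc ys] with [xs] has to be proved: the KKT conditions make [xs] critical without saying that it
    minimizes. The differentiability of the dual function rests on two quadratic bounds for the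
    squared norm of the projection. Positive definiteness of A(W) on the whole ball is read off from
    the joint subdifferential of G in (x, y), and invertibility of the limits of V from negative
    definiteness at [ys]. The contraction holds for every factor r, on a ball depending on r: r =
    1/2 fixes the radius delta and gives convergence, and arbitrarily small factors then give the
    superlinear rate. *)

Section InnerProduct.
Context {R : realType} {U : hilbertType R}.
Implicit Types (x y z : U) (a : R).

Lemma innerDl x y z : inner (x + y) z = inner x z + inner y z.
Proof. by have := innerPl 1 x y z; rewrite scale1r mul1r. Qed.

Lemma inner0l z : inner (0 : U) z = 0.
Proof. by apply: (@addrI R (inner 0 z)); rewrite -innerDl !addr0. Qed.

Lemma innerZl a x z : inner (a *: x) z = a * inner x z.
Proof. by have := innerPl a x 0 z; rewrite !addr0 inner0l addr0. Qed.

Lemma innerNl x z : inner (- x) z = - inner x z.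
Proof. by rewrite -scaleN1r innerZl mulN1r. Qed.

Lemma innerBl x y z : inner (x - y) z = inner x z - inner y z.
Proof. by rewrite innerDl innerNl. Qed.

Lemma innerDr x y z : inner x (y + z) = inner x y + inner x z.
Proof. by rewrite innerC innerDl !(innerC x). Qed.

Lemma inner0r z : inner z (0 : U) = 0.
Proof. by rewrite innerC inner0l. Qed.

Lemma innerZr a x z : inner x (a *: z) = a * inner x z.
Proof. by rewrite innerC innerZl (innerC x). Qed.

Lemma innerNr x z : inner x (- z) = - inner x z.
Proof. by rewrite innerC innerNl innerC. Qed.

Lemma innerBr x y z : inner x (y - z) = inner x y - inner x z.
Proof. by rewrite innerDr innerNr. Qed.

Definition innerE := (innerDl, innerBl, innerNl, innerZl,
  innerDr, innerBr, innerNr, innerZr).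

Lemma inner_ge0 x : 0 <= inner x x.
Proof. by rewrite -normr_inner sqr_ge0. Qed.

Lemma inner_eq0 x : inner x x = 0 -> x = 0.
Proof.
by move=> /eqP; rewrite -normr_inner sqrf_eq0 normr_eq0 => /eqP.
Qed.

Lemma inner_eq x y : (forall z, inner x z = inner y z) -> x = y.
Proof.
by move=> xy; apply/subr0_eq/inner_eq0; rewrite innerBl xy subrr.
Qed.

Lemma normrD_sqr x y : `|x + y| ^+ 2 = `|x| ^+ 2 + 2 * inner x y + `|y| ^+ 2.
Proof. by rewrite !normr_inner !innerE (innerC y x); ring. Qed.

Lemma inner_le x y : `|inner x y| <= `|x| * `|y|.
Proof.
rewrite -ler_sqr ?nnegrE ?mulr_ge0//.
rewrite real_normK ?num_real// exprMn.
have [->|x0] := eqVneq x 0; first by rewrite inner0l normr0 !expr0n mul0r.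
have xx0 : 0 < `|x| ^+ 2 by rewrite exprn_gt0// normr_gt0.
rewrite -subr_ge0 -(pmulr_rge0 _ xx0).
have := inner_ge0 (`|x| ^+ 2 *: y - inner x y *: x).
rewrite !innerE -!normr_inner (innerC y x) => /le_trans; apply.
by rewrite le_eqVlt; apply/orP; left; apply/eqP; ring.
Qed.

Lemma inner_ler x y : inner x y <= `|x| * `|y|.
Proof. exact: le_trans (ler_norm _) (inner_le x y). Qed.

End InnerProduct.

Section HomOf.
Context {R : realType} {U V : vectType R}.

Definition hom_of (f : U -> V) (f_lin : linear f) : 'Hom(U, V) :=
  linfun (HB.pack f (GRing.isLinear.Build _ _ _ _ f f_lin) : {linear U -> V}).

Lemma hom_ofE (f : U -> V) (f_lin : linear f) u : hom_of f_lin u = f u.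
Proof. by rewrite /hom_of lfunE. Qed.

End HomOf.

Section Riesz.
Context {R : realType} {U : hilbertType R}.

Fact lin_inner (w : U) : linear (fun u => inner w u : R^o).
Proof. by move=> a x y /=; rewrite !innerE. Qed.

Definition inner_hom (w : U) : 'Hom(U, R^o) := hom_of (@lin_inner w).

Lemma inner_homE w u : inner_hom w u = inner w u.
Proof. exact: hom_ofE. Qed.

Fact lin_inner_hom : linear inner_hom.
Proof.
move=> a x y; apply/lfunP => u.
by rewrite add_lfunE scale_lfunE !inner_homE !innerE.
Qed.

(** The map [w |-> inner_hom w] is injective because the inner product is definite, hence onto the
    dual space, which has the same dimension. *)
Lemma riesz (phi : 'Hom(U, R^o)) : exists w, phi = inner_hom w.
Proof.
pose T : 'Hom(U, 'Hom(U, R^o)) := hom_of lin_inner_hom.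
have TE w : T w = inner_hom w by exact: hom_ofE.
have kT : lker T = 0%VS.
  apply/eqP; rewrite -subv0; apply/subvP => w.
  rewrite memv_ker TE => /eqP w0.
  by rewrite memv0; apply/eqP/inner_eq0; rewrite -inner_homE w0 lfunE.
have TT : limg T = fullv.
  apply/eqP; rewrite eqEdim subvf/=.
  have := limg_ker_dim T fullv; rewrite kT capv0 dimv0 add0n => ->.
  by rewrite !dimvf/= /dim /= muln1.
have : phi \in limg T by rewrite TT memvf.
by move=> /memv_imgP[w _ ->]; exists w.
Qed.

End Riesz.

(** If [G] refines the image and contains [A], the preimage of the complement of [A] cannot be in
    [F], so that of [A] is. This lets compactness of a real segment be applied to coordinates. *)
Lemma fmap_ultra {T S} (f : T -> S) (F : set_system T) :
  UltraFilter F -> UltraFilter (f @ F).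
Proof.
move=> FU; split=> [|G GG FG]; first exact: fmap_proper_filter.
apply/seteqP; split=> // A GA.
have [//|FnA] := in_ultra_setVsetC (f @^-1` A) FU.
have /FG GnA : (f @ F) (~` A) by [].
by have [x []] := filter_ex (filterI GA GnA).
Qed.

Section FiniteDimension.
Context {R : realType}.
Implicit Types U V : hilbertType R.

(** The [w i] are the Riesz vectors of the coordinate forms of a basis; Cauchy-Schwarz then bounds
    coordinates without any orthonormalization. *)
Lemma dual_basis U : exists n (b w : 'I_n -> U),
  forall u, u = \sum_(i < n) inner (w i) u *: b i.
Proof.
pose b : 'I_(\dim {:U}) -> U := fun i => (vbasis {:U})`_i.
have /choice[w wP] (i : 'I_(\dim {:U})) : exists w : U, forall u,
    coord (vbasis {:U}) i u = inner w u.
  have lin_c : linear (fun u => coord (vbasis {:U}) i u : R^o).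
    by move=> a x y; rewrite linearP.
  have [w wE] := riesz (hom_of lin_c); exists w => u.
  by rewrite -inner_homE -wE hom_ofE.
exists (\dim {:U}), b, w => u.
rewrite [LHS](coord_vbasis (memvf u)).
by apply: eq_bigr => i _; rewrite wP.
Qed.

Lemma hom_bounded U V (A : 'Hom(U, V)) :
  exists2 M, 0 < M & forall u, `|A u| <= M * `|u|.
Proof.
have [n [b [w uE]]] := dual_basis U.
exists (1 + \sum_(i < n) `|w i| * `|A (b i)|) => [|u].
  by rewrite ltr_pwDl// sumr_ge0// => i _; rewrite mulr_ge0.
rewrite {1}(uE u) linear_sum mulrDl mul1r.
apply: (le_trans (ler_norm_sum _ _ _)).
rewrite -[leLHS]add0r lerD// mulr_suml.
apply: ler_sum => i _; rewrite linearZ normrZ mulrAC ler_wpM2r// inner_le//.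
Qed.

Lemma hom_continuous U V (A : 'Hom(U, V)) : continuous A.
Proof.
have [M M0 AM] := hom_bounded A.
move=> u; apply/cvgrPdist_le => e e0.
have eM0 : 0 < M^-1 * e by rewrite mulr_gt0 ?invr_gt0.
near=> v; rewrite -linearB (le_trans (AM _))// -ler_pdivlMl//.
Unshelve. all: by end_near. Qed.

Lemma cvg_hom U V T (F : set_system T) {FF : Filter F} (A : 'Hom(U, V))
    (u : T -> U) u0 : u @ F --> u0 -> (fun t => A (u t)) @ F --> A u0.
Proof. by move=> uu0; apply: continuous_cvg => //; exact: hom_continuous. Qed.

Lemma cvg_inner U T (F : set_system T) {FF : Filter F} (u v : T -> U) u0 v0 :
  u @ F --> u0 -> v @ F --> v0 ->
  (fun t => inner (u t) (v t)) @ F --> inner u0 v0.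
Proof.
move=> uu0 vv0.
have polar (x y : U) :
    inner x y = (`|x + y| ^+ 2 - `|x| ^+ 2 - `|y| ^+ 2) / 2.
  by rewrite normrD_sqr; field.
under eq_cvg do rewrite polar.
have sqr_cvg (f : T -> U) a : f @ F --> a ->
    (fun t => `|f t| ^+ 2) @ F --> `|a| ^+ 2.
  move=> fa; have na : (fun t => `|f t|) @ F --> `|a| by exact: cvg_norm.
  by rewrite expr2; under eq_cvg do rewrite expr2; exact: cvgM.
rewrite polar; apply: cvgMr_tmp.
by apply: cvgB; [apply: cvgB|]; apply: sqr_cvg => //; exact: cvgD.
Qed.

Lemma cvg_ler T (F : set_system T) {FF : ProperFilter F} (a : T -> R) l c :
  a @ F --> l -> (\forall t \near F, a t <= c) -> l <= c.
Proof.
move=> al ac; rewrite leNgt; apply/negP => cl.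
have [t [/= h1 h2]] := filter_ex (filterI ac (cvgr_gt _ al _ cl)).
by move: h1; rewrite leNgt h2.
Qed.

Lemma cvg_ger T (F : set_system T) {FF : ProperFilter F} (a : T -> R) l c :
  a @ F --> l -> (\forall t \near F, c <= a t) -> c <= l.
Proof.
move=> al ac; rewrite leNgt; apply/negP => cl.
have [t [/= h1 h2]] := filter_ex (filterI ac (cvgr_lt _ al _ cl)).
by move: h1; rewrite leNgt h2.
Qed.

(** Each coordinate stays in a compact segment, where an ultrafilter converges. *)
Lemma bounded_ultra_cvg U T (F : set_system T) {FF : UltraFilter F}
    (u : T -> U) M : (\forall t \near F, `|u t| <= M) ->
  exists u0 : U, u @ F --> u0.
Proof.
move=> uM; have [n [b [w uE]]] := dual_basis U.
have /choice[a aP] (i : 'I_n) : exists a : R,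
      (fun t => inner (w i) (u t)) @ F --> a.
  have := @segment_compact R (- (`|w i| * M)) (`|w i| * M).
  rewrite compact_ultra => /(_ ((fun t => inner (w i) (u t)) @ F)).
  case; first exact: fmap_ultra.
    apply: filterS uM => t ut; rewrite /= in_itv/= -ler_norml.
    by rewrite (le_trans (inner_le _ _))// ler_wpM2l.
  by move=> a [_ /= ?]; exists a.
exists (\sum_(i < n) a i *: b i).
under eq_cvg do rewrite (uE (u _)).
apply: cvg_big => [|i _]; first exact: add_continuous.
by apply: cvgZr_tmp; exact: aP.
Qed.

End FiniteDimension.

Section OperatorConvergence.
Context {R : realType}.
Implicit Types U V W : hilbertType R.

Lemma near_dist (U : normedModType R) T (F : set_system T) {FF : Filter F}
    (u : T -> U) u0 e :
  u @ F --> u0 -> 0 < e -> \forall t \near F, `|u t - u0| <= e.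
Proof. by move=> /cvgrPdistC_le/(_ e). Qed.

(** An operator is controlled by its values on finitely many basis vectors, so pointwise convergence
    is already uniform. *)
Lemma op_cvgP U V T (F : set_system T) {FF : Filter F} (A : T -> 'Hom(U, V)) B :
  op_cvg F A B <-> forall v, (fun t => A t v) @ F --> B v.
Proof.
split=> [AB v|AB].
  apply/cvgrPdistC_le => e e0.
  have v0 : 0 < 1 + `|v| by rewrite ltr_pwDl.
  have := AB (e / (1 + `|v|)) (divr_gt0 e0 v0).
  apply: filterS => t /(_ v)/le_trans; apply.
  by rewrite -mulrA ler_piMr ?(ltW e0)// mulrC ler_pdivrMr// mul1r lerDr.
move=> e e0; have [n [b [w uE]]] := dual_basis U.
pose M := 1 + \sum_(i < n) `|w i|.
have M0 : 0 < M by rewrite ltr_pwDl// sumr_ge0.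
have : \forall t \near F, forall i, `|A t (b i) - B (b i)| <= e / M.
  apply: filter_forall => i.
  by move/cvgrPdistC_le : (AB (b i)); apply; rewrite divr_gt0.
apply: filterS => t At v.
have -> : A t v - B v = \sum_(i < n) inner (w i) v *: (A t (b i) - B (b i)).
  under eq_bigr do rewrite scalerBr -!linearZ.
  by rewrite sumrB -!linear_sum -uE.
rewrite (le_trans (ler_norm_sum _ _ _))//.
apply: (@le_trans _ _ (\sum_(i < n) `|w i| * `|v| * (e / M))).
  apply: ler_sum => i _; rewrite normrZ.
  by rewrite ler_pM// inner_le.
rewrite -mulr_suml -mulr_suml mulrAC ler_wpM2r//.
rewrite mulrCA ler_piMr ?(ltW e0)// ler_pdivrMr// mul1r.
by rewrite /M lerDr.
Qed.

Lemma op_cvg_comp U V T (F : set_system T) {FF : Filter F}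
    (S : topologicalType) (A : S -> 'Hom(U, V)) s0 (s : T -> S) :
  op_cvg (nbhs s0) A (A s0) -> s @ F --> s0 ->
  op_cvg F (fun t => A (s t)) (A s0).
Proof. by move=> As ss0 e e0; have := ss0 _ (As e e0). Qed.

Lemma op_cvg_apply U V T (F : set_system T) {FF : Filter F}
    (A : T -> 'Hom(U, V)) B v v0 :
  op_cvg F A B -> v @ F --> v0 -> (fun t => A t (v t)) @ F --> B v0.
Proof.
move=> AB vv0; have [M M0 BM] := hom_bounded B.
have AM : \forall t \near F, forall u, `|A t u| <= (1 + M) * `|u|.
  apply: filterS (AB _ ltr01) => t At u.
  by rewrite -[A t u](subrK (B u)) (le_trans (ler_normD _ _))// mulrDl lerD.
have -> : B v0 = 0 + B v0 by rewrite add0r.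
have -> : (fun t => A t (v t)) = (fun t => A t (v t - v0) + A t v0).
  by apply/funext => t; rewrite -linearD subrK.
apply: cvgD; last by move/op_cvgP : AB; exact.
apply/cvgr0Pnorm_le => e e0.
have eM0 : 0 < (1 + M)^-1 * e by rewrite mulr_gt0// invr_gt0 ltr_wpDl.
apply: filterS2 AM (near_dist vv0 eM0) => t At vt.
by rewrite (le_trans (At _))// -ler_pdivlMl// ltr_wpDl.
Qed.

Lemma bounded_ultra_op_cvg U V T (F : set_system T) {FF : UltraFilter F}
    (A : T -> 'Hom(U, V)) M :
  (forall t v, `|A t v| <= M * `|v|) -> exists B, op_cvg F A B.
Proof.
move=> AM; have [n [b [w uE]]] := dual_basis U.
have /choice[a aP] (i : 'I_n) : exists a : V, (fun t => A t (b i)) @ F --> a.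
  by apply: (bounded_ultra_cvg (M := M * `|b i|)); exact: nearW.
have lin_B : linear (fun v => \sum_(i < n) inner (w i) v *: a i).
  move=> k x y; rewrite scaler_sumr -big_split; apply: eq_bigr => i _ /=.
  by rewrite !innerE scalerDl scalerA.
exists (hom_of lin_B); apply/op_cvgP => v; rewrite hom_ofE.
have -> : (fun t => A t v) = (fun t => \sum_(i < n) inner (w i) v *: A t (b i)).
  apply/funext => t; rewrite {1}(uE v) linear_sum.
  by apply: eq_bigr => i _; rewrite linearZ.
apply: cvg_big => [|i _]; first exact: add_continuous.
by apply: cvgZl_tmp; exact: aP.
Qed.

(** If [M] bounds the inverse of [B], then [B] is bounded below by 1/M, and half of this bound
    survives a perturbation of size 1/(2M). The result is a bound on the inverses that is uniform
    near the limit. *)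
Lemma op_cvg_bounded_below U T (F : set_system T) {FF : Filter F}
    (A : T -> 'End(U)) B : op_cvg F A B -> lker B = 0%VS ->
  exists2 k, 0 < k & \forall t \near F, forall v, k * `|v| <= `|A t v|.
Proof.
move=> AB kB; have [M M0 BM] := hom_bounded (B^-1)%VF.
have Bk v : M^-1 * `|v| <= `|B v|.
  rewrite ler_pdivrMl//; have := BM (B v).
  by rewrite lker0_lfunK// kB.
exists (M^-1 / 2) => [|]; first by rewrite divr_gt0// invr_gt0.
have M2 : 0 < M^-1 / 2 by rewrite divr_gt0// invr_gt0.
apply: filterS (AB _ M2) => t At v.
have := Bk v; rewrite -{1}[B v](subrK (A t v)) => /le_trans/(_ (ler_normD _ _)).
by have := At v; rewrite distrC; lra.
Qed.

Lemma lker0_injP U V (A : 'Hom(U, V)) :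
  (forall u, A u = 0 -> u = 0) -> lker A = 0%VS.
Proof.
move=> Ainj; apply/eqP; rewrite -subv0; apply/subvP => u.
by rewrite memv_ker memv0 => /eqP/Ainj ->.
Qed.

Lemma lker0_bounded_below U V (A : 'Hom(U, V)) k : 0 < k ->
  (forall v, k * `|v| <= `|A v|) -> lker A = 0%VS.
Proof.
move=> k0 kA; apply: lker0_injP => u Au; apply/eqP.
by rewrite -normr_le0 -(pmulr_rle0 _ k0) (le_trans (kA u))// Au normr0.
Qed.

(** Applying [A t] to the difference of the two inverses at [v] leaves [v - A t (B^-1 v)], up to
    sign, which tends to 0; the uniform lower bound carries this back to the difference itself. *)
Lemma op_cvg_inv U T (F : set_system T) {FF : Filter F}
    (A : T -> 'End(U)) B : op_cvg F A B -> lker B = 0%VS ->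
  op_cvg F (fun t => (A t)^-1%VF) (B^-1)%VF.
Proof.
move=> AB kB; have [k k0 kA] := op_cvg_bounded_below AB kB.
apply/op_cvgP => v; apply/cvgrPdistC_le => e e0.
have ABv : (fun t => A t ((B^-1)%VF v)) @ F --> B ((B^-1)%VF v).
  by move/op_cvgP : AB; exact.
have ke0 : 0 < k * e by rewrite mulr_gt0.
apply: filterS2 kA (near_dist ABv ke0) => t kAt.
have kerA := lker0_bounded_below k0 kAt.
have iB : B ((B^-1)%VF v) = v.
  by rewrite lker0_lfunVK// kB.
have iA : A t ((A t)^-1%VF v) = v by rewrite lker0_lfunVK// kerA.
rewrite iB => ABt; rewrite -(ler_pM2l k0).
by rewrite (le_trans (kAt _))// linearB/= iA distrC.
Qed.

End OperatorConvergence.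

Section Adjoint.
Context {R : realType} {U V : hilbertType R}.
Implicit Types (A : 'Hom(U, V)).

(** The set under [xget] is nonempty: Riesz gives a vector for each [v], and its uniqueness makes
    the choice linear. *)
Lemma adjointP A u v : inner (A u) v = inner u (adjoint A v).
Proof.
suff : exists B : 'Hom(V, U), forall u v, inner (A u) v = inner u (B v).
  by move=> exB; exact: (@xgetPex _ 0 [set B : 'Hom(V, U) |
    forall u v, inner (A u) v = inner u (B v)] exB).
have /choice[f fP] y : exists x, forall u, inner (A u) y = inner x u.
  have [x xE] := riesz (inner_hom y \o A)%VF.
  by exists x => z; rewrite innerC -!inner_homE -xE comp_lfunE.
have lin_f : linear f.
  move=> a x y; apply: inner_eq => z.
  by rewrite -fP innerDr innerZr !fP innerDl innerZl.
by exists (hom_of lin_f) => x y; rewrite hom_ofE fP innerC.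
Qed.

Lemma adjointPr A u v : inner (adjoint A v) u = inner v (A u).
Proof. by rewrite innerC -adjointP innerC. Qed.

Lemma adjoint_expand A n (b w : 'I_n -> U) v :
  (forall u, u = \sum_(i < n) inner (w i) u *: b i) ->
  adjoint A v = \sum_(i < n) inner v (A (w i)) *: b i.
Proof.
move=> uE; rewrite {1}(uE (adjoint A v)); apply: eq_bigr => i _.
by rewrite -adjointP innerC.
Qed.

Lemma op_cvg_adjoint T (F : set_system T) {FF : Filter F}
    (A : T -> 'Hom(U, V)) B :
  op_cvg F A B -> op_cvg F (fun t => adjoint (A t)) (adjoint B).
Proof.
move=> /op_cvgP AB; apply/op_cvgP => v.
have [n [b [w uE]]] := dual_basis U.
rewrite (adjoint_expand _ _ uE).
have -> : (fun t => adjoint (A t) v)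
    = (fun t => \sum_(i < n) inner v (A t (w i)) *: b i).
  by apply/funext => t; rewrite (adjoint_expand _ _ uE).
apply: cvg_big => [|i _]; first exact: add_continuous.
by apply: cvgZr_tmp; apply: cvg_inner => //; exact: cvg_cst.
Qed.

End Adjoint.

(** * Derivatives along a filter *)

Section DerivativeAlong.
Context {R : realType}.
Implicit Types U V W : hilbertType R.

(* Along the filter F, the increment of a is the image of that of u under A, up
   to an error negligible with respect to the increment of u. For T = U, u = id
   and F the neighbourhoods of u0 this is differentiability at u0. *)
Definition diff_along T (F : set_system T) U V (u : T -> U) (u0 : U)
    (a : T -> V) (a0 : V) (A : 'Hom(U, V)) : Prop :=
  forall e : R, 0 < e ->
    \forall t \near F, `|a t - a0 - A (u t - u0)| <= e * `|u t - u0|.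

Section Rules.
Context {T : Type} {F : set_system T} {FF : Filter F}.
Context {U : hilbertType R} (u : T -> U) (u0 : U).

Lemma diff_along_cst V (a : V) : diff_along F u u0 (fun=> a) a 0.
Proof.
by move=> e e0; apply: nearW => t; rewrite lfunE/= !subrr normr0 mulr_ge0// ltW.
Qed.

Lemma diff_alongD V (a b : T -> V) a0 b0 A B :
  diff_along F u u0 a a0 A -> diff_along F u u0 b b0 B ->
  diff_along F u u0 (fun t => a t + b t) (a0 + b0) (A + B).
Proof.
move=> aA bB e e0; have e2 : 0 < e / 2 by rewrite divr_gt0.
apply: filterS2 (aA _ e2) (bB _ e2) => t At Bt.
have -> : a t + b t - (a0 + b0) - (A + B) (u t - u0)
    = (a t - a0 - A (u t - u0)) + (b t - b0 - B (u t - u0)).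
  by rewrite add_lfunE !opprD (addrACA (a t)) [LHS]addrACA.
by rewrite (le_trans (ler_normD _ _))//; move: At Bt; lra.
Qed.

Lemma diff_along_eq V (a b : T -> V) a0 b0 A :
  diff_along F u u0 a a0 A -> (forall t, a t = b t) -> a0 = b0 ->
  diff_along F u u0 b b0 A.
Proof. by move=> + /funext <- <-. Qed.

Lemma diff_along_comp V W (a : T -> V) a0 A (b : T -> W) b0 B :
  diff_along F u u0 a a0 A -> diff_along F a a0 b b0 B ->
  diff_along F u u0 b b0 (B \o A)%VF.
Proof.
move=> aA bB e e0.
have [M M0 BM] := hom_bounded B; have [N N0 AN] := hom_bounded A.
pose d := e / (1 + N + M).
have s0 : 0 < 1 + N + M by rewrite !addr_gt0.
have d0 : 0 < d by rewrite divr_gt0.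
apply: filterS3 (aA _ ltr01) (aA _ d0) (bB _ d0) => t At1 At Bt.
have -> : b t - b0 - (B \o A)%VF (u t - u0)
    = (b t - b0 - B (a t - a0)) + B (a t - a0 - A (u t - u0)).
  by rewrite comp_lfunE (linearB _ (a t - a0)) /= addrA subrK.
have au : `|a t - a0| <= (1 + N) * `|u t - u0|.
  rewrite -[a t - a0](subrK (A (u t - u0))) (le_trans (ler_normD _ _))//.
  by rewrite mulrDl lerD.
rewrite (le_trans (ler_normD _ _))//.
have -> : e = d * (1 + N) + M * d by rewrite /d; field; rewrite gt_eqF.
rewrite mulrDl lerD//.
  by rewrite (le_trans Bt)// -mulrA ler_wpM2l// ltW.
by rewrite (le_trans (BM _))// -mulrA ler_wpM2l// ltW.
Qed.

Lemma diff_along_lin V W (a : T -> V) a0 A (B : 'Hom(V, W)) :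
  diff_along F u u0 a a0 A ->
  diff_along F u u0 (fun t => B (a t)) (B a0) (B \o A)%VF.
Proof.
move=> aA; apply: diff_along_comp aA _ => e e0; apply: nearW => t.
by rewrite linearB subrr normr0 mulr_ge0// ltW.
Qed.

Lemma diff_alongZ V (a : T -> V) a0 A k :
  diff_along F u u0 a a0 A ->
  diff_along F u u0 (fun t => k *: a t) (k *: a0) (k *: A).
Proof.
move=> aA; have -> : k *: A = ((k *: \1) \o A)%VF.
  by apply/lfunP => x; rewrite comp_lfunE !scale_lfunE id_lfunE.
have -> : (fun t => k *: a t) = (fun t => (k *: \1)%VF (a t)).
  by apply/funext => t; rewrite scale_lfunE id_lfunE.
have -> : k *: a0 = (k *: \1)%VF a0 by rewrite scale_lfunE id_lfunE.
exact: diff_along_lin.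
Qed.

Lemma diff_alongN V (a : T -> V) a0 A :
  diff_along F u u0 a a0 A ->
  diff_along F u u0 (fun t => - a t) (- a0) (- A).
Proof.
move=> /(diff_alongZ (-1)); rewrite !scaleN1r.
by under eq_fun do rewrite scaleN1r.
Qed.

Lemma diff_alongB V (a b : T -> V) a0 b0 A B :
  diff_along F u u0 a a0 A -> diff_along F u u0 b b0 B ->
  diff_along F u u0 (fun t => a t - b t) (a0 - b0) (A - B).
Proof. by move=> aA /diff_alongN; exact: diff_alongD. Qed.

Lemma diff_along_sum V n (a : 'I_n -> T -> V) a0 A :
  (forall i, diff_along F u u0 (a i) (a0 i) (A i)) ->
  diff_along F u u0 (fun t => \sum_(i < n) a i t) (\sum_(i < n) a0 i)
    (\sum_(i < n) A i).
Proof.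
move=> aA.
have step (r : seq 'I_n) : diff_along F u u0 (fun t => \sum_(i <- r) a i t)
    (\sum_(i <- r) a0 i) (\sum_(i <- r) A i).
  elim: r => [|i r ih].
    rewrite !big_nil; under eq_fun do rewrite big_nil.
    exact: diff_along_cst.
  rewrite !big_cons; under eq_fun do rewrite big_cons.
  exact: diff_alongD.
exact: step.
Qed.

(** Product rule where one factor vanishes at the base point: the variation of [B] only meets a
    small increment, so convergence of [B] suffices. *)
Lemma diff_along_op_cvg V W (a : T -> V) a0 A (B : T -> 'Hom(V, W)) B0 :
  op_cvg F B B0 -> diff_along F u u0 a a0 A ->
  diff_along F u u0 (fun t => B t (a t - a0)) 0 (B0 \o A)%VF.
Proof.
move=> BB0 aA; apply: diff_along_comp aA _ => e e0.
by apply: filterS (BB0 _ e0) => t Bt; rewrite subr0.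
Qed.

Lemma diff_along_cvg V (a : T -> V) a0 A :
  u @ F --> u0 -> diff_along F u u0 a a0 A -> a @ F --> a0.
Proof.
move=> uu0 aA; have [M M0 AM] := hom_bounded A.
apply/cvgrPdistC_le => e e0.
have e1 : 0 < (1 + M)^-1 * e by rewrite mulr_gt0// invr_gt0 addr_gt0.
apply: filterS2 (aA _ ltr01) (near_dist uu0 e1) => t At ut.
rewrite -[a t - a0](subrK (A (u t - u0))) (le_trans (ler_normD _ _))//.
apply: (@le_trans _ _ ((1 + M) * `|u t - u0|)).
  by rewrite mulrDl lerD.
by rewrite -ler_pdivlMl// addr_gt0.
Qed.

End Rules.

Lemma diff_along_sqr T (F : set_system T) {FF : Filter F} U V (u : T -> U) u0
    (a : T -> V) a0 A :
  u @ F --> u0 -> diff_along F u u0 a a0 A ->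
  diff_along F u u0 (fun t => `|a t| ^+ 2 : R^o) (`|a0| ^+ 2)
    (inner_hom (2 *: a0) \o A)%VF.
Proof.
move=> uu0 aA; apply: diff_along_comp (aA) _ => e e0.
apply: filterS (near_dist (diff_along_cvg uu0 aA) e0) => t At.
rewrite inner_homE.
have -> : (`|a t| ^+ 2 - `|a0| ^+ 2 - inner (2 *: a0) (a t - a0) : R^o)
    = `|a t - a0| ^+ 2 :> R.
  by rewrite !normr_inner !innerE (innerC a0 (a t)); ring.
by rewrite expr2 normrM normr_id ler_wpM2r.
Qed.

Lemma diff_alongP U V (F : U -> V) (u0 : U) (A : 'Hom(U, V)) :
  diff_along (nbhs u0) id u0 F (F u0) A -> differentiable F u0 /\ jac F u0 = A.
Proof.
move=> FA.
have FE : F \o shift u0 = cst (F u0) + A +o_ 0 id.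
  apply/eqaddoP => e e0.
  have : \forall t \near u0, `|F t - F u0 - A (t - u0)| <= e * `|t - u0|.
    exact: FA.
  rewrite (near_shift 0) /=; apply: filterS => h; rewrite subr0 /= addrK.
  by rewrite !fctE /= opprD addrA.
have cA : continuous A by exact: hom_continuous.
have dA := diff_unique cA FE.
split; first by apply/diff_locallyP; split; rewrite dA.
by apply/lfunP => v; rewrite lfunE/= dA.
Qed.

Lemma differentiable_along U V (F : U -> V) (u0 : U) T (G : set_system T)
    {GG : Filter G} (u : T -> U) :
  differentiable F u0 -> u @ G --> u0 ->
  diff_along G u u0 (F \o u) (F u0) (jac F u0).
Proof.
move=> /diff_locallyP[_ /eqaddoP dF] uu0 e e0.
have uu : (fun t => u t - u0) @ G --> (0 : U).
  by apply/subr_cvg0.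
have dFu : \forall t \near G, `|(F \o shift u0 - (cst (F u0) + 'd F u0))
    (u t - u0)| <= e * `|u t - u0| := uu _ (dF e e0).
by apply: filterS dFu => t; rewrite !fctE /= subrK opprD addrA lfunE.
Qed.

Lemma diff_along_comp_differentiable U V W T (G : set_system T) {GG : Filter G}
    (u : T -> U) u0 (a : T -> V) a0 A (F : V -> W) :
  u @ G --> u0 -> diff_along G u u0 a a0 A -> differentiable F a0 ->
  diff_along G u u0 (fun t => F (a t)) (F a0) (jac F a0 \o A)%VF.
Proof.
move=> uu0 aA dF; apply: diff_along_comp (aA) _.
exact: differentiable_along (diff_along_cvg uu0 aA).
Qed.

Lemma gradP U (phi : U -> R^o) u v : inner (grad phi u) v = jac phi u v.
Proof. by rewrite innerC -adjointP /inner/= mulr1. Qed.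

Lemma grad_eq U (phi : U -> R^o) u w :
  (forall v, jac phi u v = inner w v) -> grad phi u = w.
Proof. by move=> phiw; apply: inner_eq => v; rewrite gradP phiw. Qed.

(** [C2] speaks of evaluations of the Jacobian, Hessians of its adjoint; expanding the adjoint in
    coordinates reduces the second to the first. *)
Lemma C2_adjoint_diff U V (F : U -> V) u v n (b w : 'I_n -> U) : C2 F ->
  (forall x, x = \sum_(i < n) inner (w i) x *: b i) ->
  differentiable (fun x => adjoint (jac F x) v) u /\
  forall d, jac (fun x => adjoint (jac F x) v) u d
    = \sum_(i < n) inner v (jac (fun x => jac F x (w i)) u d) *: b i.
Proof.
move=> [_ F2] uE.
pose lb i : R^o -> U := fun r => (r : R) *: b i.
have lin_b i : linear (lb i).
  by move=> k x y; rewrite /lb scalerDl -scalerA.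
pose L i := (hom_of (lin_b i) \o inner_hom v)%VF.
have LE i x : L i x = inner v x *: b i.
  by rewrite /L comp_lfunE hom_ofE inner_homE.
have dL i : diff_along (nbhs u) id u (fun x => L i (jac F x (w i)))
    (L i (jac F u (w i))) (L i \o jac (fun x => jac F x (w i)) u)%VF.
  apply: diff_along_lin.
  exact: (differentiable_along (F2 (w i) u).1 (@cvg_id _ _)).
have -> : (fun x => adjoint (jac F x) v)
    = (fun x => \sum_(i < n) L i (jac F x (w i))).
  apply/funext => x; rewrite (adjoint_expand _ _ uE).
  by apply: eq_bigr => i _; rewrite LE.
have [dF ->] := diff_alongP (diff_along_sum dL).
split=> // d; rewrite sum_lfunE; apply: eq_bigr => i _.
by rewrite comp_lfunE LE.
Qed.

Lemma C2_adjoint_differentiable U V (F : U -> V) u v : C2 F ->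
  differentiable (fun x => adjoint (jac F x) v) u.
Proof.
move=> F2; have [n [b [w uE]]] := dual_basis U.
by have [] := C2_adjoint_diff u v F2 uE.
Qed.

Lemma C2_adjoint_jac_cvg U V (F : U -> V) T (G : set_system T) {GG : Filter G}
    (u : T -> U) u0 (v : T -> V) v0 d :
  C2 F -> u @ G --> u0 -> v @ G --> v0 ->
  (fun t => jac (fun x => adjoint (jac F x) (v t)) (u t) d) @ G
    --> jac (fun x => adjoint (jac F x) v0) u0 d.
Proof.
move=> F2 uu0 vv0; have [n [b [w uE]]] := dual_basis U.
have [_ ->] := C2_adjoint_diff u0 v0 F2 uE.
have -> : (fun t => jac (fun x => adjoint (jac F x) (v t)) (u t) d) = (fun t =>
    \sum_(i < n) inner (v t) (jac (fun x => jac F x (w i)) (u t) d) *: b i).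
  by apply/funext => t; have [_ ->] := C2_adjoint_diff (u t) (v t) F2 uE.
apply: cvg_big => [|i _]; first exact: add_continuous.
apply: cvgZr_tmp; apply: cvg_inner => //.
have /op_cvgP := op_cvg_comp (FF := GG) (F2.2 (w i) u0).2 uu0.
exact.
Qed.

End DerivativeAlong.

(** * Projection onto a self-dual cone *)

Section SelfDualProjection.
Context {R : realType} {Z : hilbertType R} (K : set Z).
Hypothesis K_dual : self_dual K.
Local Notation P := (metric_proj K).
Implicit Types (u v p q : Z).

Lemma self_dualP p : K p <-> forall q, K q -> 0 <= inner p q.
Proof. by split=> [|Kp]; rewrite [K in K p]K_dual. Qed.

Lemma self_dual0 : K 0.
Proof. by apply/self_dualP => q _; rewrite inner0l. Qed.

Lemma self_dualD p q : K p -> K q -> K (p + q).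
Proof.
move=> /self_dualP Kp /self_dualP Kq; apply/self_dualP => r Kr.
by rewrite innerDl addr_ge0 ?Kp ?Kq.
Qed.

Lemma self_dualZ (a : R) p : 0 <= a -> K p -> K (a *: p).
Proof.
move=> a0 /self_dualP Kp; apply/self_dualP => r Kr.
by rewrite innerZl mulr_ge0 ?Kp.
Qed.

(** A minimizing sequence is bounded, hence converges along an ultrafilter. Its limit stays in [K]
    because self-duality writes [K] as an intersection of closed half-spaces. *)
Lemma metric_proj_min u : K (P u) /\ forall q, K q -> `|u - P u| <= `|u - q|.
Proof.
suff : exists p, K p /\ forall q, K q -> `|u - p| <= `|u - q|.
  by move=> exP; exact: (@xgetPex _ 0 [set p |
    K p /\ forall q, K q -> `|u - p| <= `|u - q|] exP).
pose D := [set `|u - q| | q in K].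
have D_inf : has_inf D.
  split; first by exists `|u - 0|, 0 => //; exact: self_dual0.
  by exists 0 => _ [q _ <-].
have /choice[q qP] (n : nat) : exists q, K q /\ `|u - q| <= inf D + n.+1%:R^-1.
  have n0 : 0 < n.+1%:R^-1 :> R by rewrite invr_gt0.
  have [_ [q Kq <-] qn] := inf_adherent n0 D_inf.
  by exists q; split=> //; exact: ltW.
have [F [FU sF]] := @ultraFilterLemma nat \oo _.
have [|p qp] := bounded_ultra_cvg (u := q) (F := F) (M := `|u| + (inf D + 1)).
  apply: nearW => n; rewrite -[q n](subrK u) addrC (le_trans (ler_normD _ _))//.
  rewrite lerD2l distrC (le_trans (qP n).2)// lerD2l invf_le1//.
  by rewrite ler1n.
have ninv : (fun n => inf D + n.+1%:R^-1) @ F --> inf D + 0.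
  apply: cvgD; first exact: cvg_cst.
  by apply: cvg_trans (@cvg_harmonic R) => A /sF.
exists p; split=> [|r Kr].
  apply/self_dualP => r Kr.
  apply: (@cvg_ger _ _ F _ (fun n => inner (q n) r)).
    by apply: cvg_inner => //; exact: cvg_cst.
  by apply: nearW => n; have /self_dualP := (qP n).1; exact.
have upD : `|u - p| <= inf D.
  rewrite -subr_le0.
  apply: (@cvg_ler _ _ F _ (fun n => `|u - q n| - (inf D + n.+1%:R^-1))).
    rewrite -[inf D in X in _ --> X]addr0.
    apply: cvgB => //; apply: cvg_norm; apply: cvgB => //; exact: cvg_cst.
  by apply: nearW => n; rewrite subr_le0 (qP n).2.
by apply: (le_trans upD); apply: ge_inf; [exact: D_inf.2|exists r].
Qed.

Lemma metric_proj_in u : K (P u).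
Proof. exact: (metric_proj_min u).1. Qed.

Lemma metric_proj_le u q : K q -> `|u - P u| <= `|u - q|.
Proof. exact: (metric_proj_min u).2. Qed.

(** First-order optimality: divide by [t] and let it tend to 0. The range t <= 1 keeps the factor 1
    - t nonnegative when a point of the cone is scaled. *)
Let small_quad (a b : R) :
  (forall t, 0 < t <= 1 -> a * t <= b * t ^+ 2) -> a <= 0.
Proof.
move=> ab; rewrite leNgt; apply/negP => a0.
have b1 : 0 < 1 + `|b| by rewrite ltr_pwDl.
pose t := Num.min 1 (a / (2 * (1 + `|b|))).
have t0 : 0 < t by rewrite lt_min ltr01 divr_gt0// mulr_gt0.
have := ab t; rewrite t0 ge_min lexx/= => /(_ isT).
rewrite expr2 mulrA ler_pM2r// => abt.
have : t * (2 * (1 + `|b|)) <= a.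
  by rewrite -ler_pdivlMr ?mulr_gt0// ge_min lexx orbT.
have : b * t <= `|b| * t by rewrite ler_wpM2r ?(ltW t0)// ler_norm.
by move: a0 abt t0 b1; nra.
Qed.

Lemma metric_proj_dual u : K (P u - u).
Proof.
apply/self_dualP => q Kq; rewrite -oppr_le0.
apply: (@small_quad _ (`|q| ^+ 2 / 2)) => t /andP[t0 _].
have := metric_proj_le u (self_dualD (metric_proj_in u)
  (self_dualZ (ltW t0) Kq)).
rewrite -ler_sqr ?nnegrE// opprD addrA (normrD_sqr (u - P u)) -addrA lerDl.
by rewrite -opprB normrN normrZ exprMn (gtr0_norm t0) !innerE; lra.
Qed.

Lemma metric_proj_orth u : inner (P u - u) (P u) = 0.
Proof.
apply/eqP; rewrite eq_le; apply/andP; split; last first.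
  by have /self_dualP := metric_proj_dual u; apply; exact: metric_proj_in.
apply: (@small_quad _ (`|P u| ^+ 2 / 2)) => t /andP[t0 t1].
have Kt : K ((1 - t) *: P u).
  by apply: self_dualZ; [rewrite subr_ge0|exact: metric_proj_in].
have := metric_proj_le u Kt.
rewrite scalerBl scale1r opprB addrCA addrC -ler_sqr ?nnegrE//.
rewrite (normrD_sqr (u - P u)) -addrA lerDl normrZ exprMn (gtr0_norm t0).
by rewrite !innerE; lra.
Qed.

(** In the expansion of the inner product of P u - p with (P u - u) - (p - u), which is the squared
    distance, the diagonal terms vanish and the cross terms enter with a minus sign, nonnegative by
    duality. *)
Lemma metric_proj_eq u p :
  K p -> K (p - u) -> inner (p - u) p = 0 -> P u = p.
Proof.
move=> Kp Kpu pu0; apply/subr0_eq/inner_eq0/eqP.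
rewrite eq_le inner_ge0 andbT.
have /self_dualP/(_ _ Kp) := metric_proj_dual u.
have /self_dualP/(_ _ (metric_proj_in u)) := Kpu.
have := metric_proj_orth u; move: pu0; rewrite !innerE.
by have := innerC (P u) p; have := innerC p u; lra.
Qed.

(* Moreau's decomposition u = P u - (P u - u) of both points. *)
Lemma metric_proj_moreau u v :
  `|P v - P u| ^+ 2 + 2 * inner (P u) (P v - v)
    = `|P v| ^+ 2 - `|P u| ^+ 2 - 2 * inner (P u) (v - u).
Proof.
have := metric_proj_orth u; rewrite !normr_inner !innerE.
by have := innerC (P v) (P u); have := innerC u (P u); lra.
Qed.

Let cross_ge0 u v : 0 <= inner (P u) (P v - v).
Proof.
by have /self_dualP := metric_proj_in u; apply; exact: metric_proj_dual.
Qed.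

(** Moreau's decomposition makes v - u the difference of the two vectors whose norms appear;
    orthogonality at [u] and at [v] leaves only cross terms. *)
Let dist_split u v : `|v - u| ^+ 2 = `|P v - P u| ^+ 2
  + `|(P v - v) - (P u - u)| ^+ 2
  + 2 * (inner (P v) (P u - u) + inner (P u) (P v - v)).
Proof.
have := metric_proj_orth u; have := metric_proj_orth v.
rewrite !normr_inner !innerE (innerC (P v) (P u)) (innerC u (P u)).
by have := innerC v (P v); have := innerC (P u) v; have := innerC (P v) u;
  have := innerC u v; lra.
Qed.

Lemma metric_proj_lipschitz u v : `|P v - P u| <= `|v - u|.
Proof.
rewrite -ler_sqr ?nnegrE// (dist_split u v).
have := cross_ge0 u v; have := cross_ge0 v u.
by have := sqr_ge0 `|P v - v - (P u - u)|; lra.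
Qed.

(** With the next lemma: half the squared norm of the projection is convex, and its gradient [P]
    satisfies the descent inequality with constant 1. Both bounds serve again for the augmented
    Lagrangian as a function of the multiplier. *)
Lemma metric_proj_sqr_ge u v :
  2 * inner (P u) (v - u) <= `|P v| ^+ 2 - `|P u| ^+ 2.
Proof.
have := metric_proj_moreau u v; have := cross_ge0 u v.
by have := sqr_ge0 `|P v - P u|; lra.
Qed.

Lemma metric_proj_sqr_le u v :
  `|P v| ^+ 2 - `|P u| ^+ 2 <= 2 * inner (P u) (v - u) + `|v - u| ^+ 2.
Proof.
have := metric_proj_moreau u v; rewrite (dist_split u v).
have := cross_ge0 v u.
by have := sqr_ge0 `|P v - v - (P u - u)|; lra.
Qed.

Lemma metric_proj_sqr_diff u :
  diff_along (nbhs u) id u (fun v => `|P v| ^+ 2 : R^o) (`|P u| ^+ 2)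
    (inner_hom (2 *: P u)).
Proof.
move=> e e0; have : \forall v \near u, `|v - u| <= e.
  by apply: near_dist => //; exact: cvg_id.
apply: filterS => v ve; rewrite inner_homE innerZl.
have : `|v - u| ^+ 2 <= e * `|v - u| by rewrite expr2 ler_wpM2r.
have := metric_proj_sqr_le u v; have := metric_proj_sqr_ge u v => h1 h2 h3.
by rewrite ger0_norm; [move: h1 h2 h3|]; lra.
Qed.

End SelfDualProjection.

(** * Differentiability on a dense set *)

Section RealFunctions.
Context {R : realType}.

(** A minimum of [psi] is attained, and the hypothesis excludes every point except [b]. One smaller
    value to the right of each point is enough; no local monotonicity is asked for. *)
Lemma descent_le (psi : R -> R) a b : a <= b ->
  {within `[a, b], continuous psi} ->
  (forall s, a <= s < b -> exists2 s', s < s' <= b & psi s' < psi s) ->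
  psi b <= psi a.
Proof.
move=> ab psi_cont psi_desc; have [c /itvP cab cmin] := EVT_min ab psi_cont.
have [cb|] := ltP c b.
  have [|s' /andP[cs s'b] ps'] := psi_desc c; first by rewrite cb cab.
  have : psi c <= psi s'.
    by apply: cmin; rewrite in_itv/= s'b andbT (le_trans _ (ltW cs))// cab.
  by rewrite leNgt ps'.
move=> bc; have <- : c = b by apply/eqP; rewrite eq_le bc cab.
by apply: cmin; rewrite in_itv/= lexx.
Qed.

End RealFunctions.

Section Baire.
Context {R : realType} {U : hilbertType R}.

Lemma hilbert_complete (F : set_system U) : ProperFilter F -> cauchy F -> cvg F.
Proof.
move=> FF /cauchyP cF; have [G [GU FG]] := ultraFilterLemma FF.
have near_center x e : F (ball x e) -> \forall y \near G, `|y - x| <= e.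
  move=> /FG; apply: filterS => y; rewrite -ball_normE/= distrC => /ltW.
  by [].
have [x0 x0F] := cF 1 ltr01.
have [|l Gl] := bounded_ultra_cvg (u := id) (F := G) (M := 1 + `|x0|).
  apply: filterS (near_center _ _ x0F) => y xy.
  by rewrite -[y](subrK x0) (le_trans (ler_normD _ _))// lerD2r.
apply/cvg_ex; exists l; apply/cvgrPdist_le => e e0.
have e2 : 0 < e / 2 by rewrite divr_gt0.
have [x xF] := cF _ e2.
have lx : `|l - x| <= e / 2.
  apply: (@cvg_ler _ _ G _ (fun y => `|y - x|)); last exact: near_center.
  by apply: cvg_norm; apply: cvgB => //; exact: cvg_cst.
apply: filterS xF => y; rewrite -ball_normE/= => /ltW xy.
by rewrite -[l - y](subrKA x) (le_trans (ler_normD _ _))// [e]splitr lerD.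
Qed.

Lemma hilbert_Baire (O : (set U)^nat) :
  (forall i, open (O i) /\ dense (O i)) -> dense (\bigcap_i (O i)).
Proof.
pose Uc : completeNormedModType R :=
  HB.pack U (Uniform_isComplete.Build U hilbert_complete).
exact: (@Baire R Uc).
Qed.

End Baire.

Lemma ball_convex_comb {R : realType} {U : hilbertType R} (u p q : U) r k :
  0 <= k <= 1 -> ball u r p -> ball u r q -> ball u r ((1 - k) *: p + k *: q).
Proof.
move=> /andP[k0 k1]; rewrite -!ball_normE/= => up uq.
have -> : u - ((1 - k) *: p + k *: q) = (1 - k) *: (u - p) + k *: (u - q).
  rewrite !scalerBr addrACA -scalerDl subrK scale1r opprD.
  by [].
rewrite (le_lt_trans (ler_normD _ _))// !normrZ !ger0_norm ?subr_ge0//.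
have [->|k1'] := eqVneq k 1; first by rewrite subrr mul0r add0r mul1r.
have -> : r = (1 - k) * r + k * r by ring.
apply: ltr_leD; last by rewrite ler_wpM2l// ltW.
by rewrite ltr_pM2l// subr_gt0 lt_neqAle k1'.
Qed.

Lemma ball_segment {R : realType} {U : hilbertType R} (u p b : U) r (s t : R) :
  0 <= s <= t -> ball u r p -> ball u r (p + t *: b) -> ball u r (p + s *: b).
Proof.
move=> /andP[s0 st] up upt.
have [t0|tN0] := eqVneq t 0.
  by have -> : s = t by apply/eqP; rewrite eq_le st t0.
have t0 : 0 < t by rewrite lt_neqAle eq_sym tN0 (le_trans s0).
have -> : p + s *: b = (1 - s / t) *: p + (s / t) *: (p + t *: b).
  by rewrite scalerBl scale1r scalerDr addrA subrK scalerA divfK.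
apply: ball_convex_comb => //.
by rewrite divr_ge0 ?(ltW t0)//= ler_pdivrMr// mul1r.
Qed.

Section DenseDifferentiability.
Context {R : realType} {U V : hilbertType R} (F : U -> V).
Hypothesis F_cont : continuous F.
Hypothesis F_dir : forall u, dir_differentiable F u.

Let quot (b : U) (n : nat) (u : U) : V :=
  n.+1%:R *: (F (u + n.+1%:R^-1 *: b) - F u).

Let quot_cvg b u : exists l : V, quot b ^~ u @ \oo --> l.
Proof.
have /cvg_ex[l Fl] := @F_dir u b.
have inv0 : (fun n => n.+1%:R^-1 : R) @ \oo --> (0 : R)^'+.
  move=> A A0.
  have hA : \forall n \near \oo, 0 < n.+1%:R^-1 :> R -> A n.+1%:R^-1 :=
    @cvg_harmonic R _ A0.
  by apply: filterS hA => n; apply; rewrite invr_gt0.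
exists l; have -> : quot b ^~ u
    = (fun t => t^-1 *: (F (u + t *: b) - F u)) \o (fun n => n.+1%:R^-1).
  by apply/funext => n; rewrite /= invrK.
exact: cvg_comp inv0 Fl.
Qed.

Let quot_continuous b n : continuous (quot b n).
Proof.
move=> u; apply: cvgZl_tmp; apply: cvgB; last exact: F_cont.
apply: continuous_comp; last exact: F_cont.
by apply: cvgD; [exact: cvg_id|exact: cvg_cst].
Qed.

(** The closed sets [E N], where the quotients have settled within [e] from index N on, cover the
    space by pointwise convergence; by Baire one of them contains an open part of [O]. *)
Let quot_stable b (e : R) (O : set U) : 0 < e -> open O -> O !=set0 ->
  exists N (O' : set U), [/\ open O', O' !=set0, O' `<=` O &
    forall u n, O' u -> (N <= n)%N -> `|quot b n u - quot b N u| <= e].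
Proof.
move=> e0 oO O0.
pose E N := [set u | forall n, (N <= n)%N -> `|quot b n u - quot b N u| <= e].
have clE N : closed (E N).
  have -> : E N = \bigcap_(n in [set n | (N <= n)%N])
      ((fun u => `|quot b n u - quot b N u|) @^-1` [set x | x <= e]).
    by apply/seteqP; split=> u Eu n; exact: Eu.
  apply: closed_bigI => n _.
  apply: (continuous_closedP _).1; last exact: closed_le.
  move=> u; apply: cvg_norm; apply: cvgB; exact: quot_continuous.
apply: contrapT => noO'.
(* Intersecting with the closure of [O] localizes the argument: an open set missing [O] also misses
   the closure, and one meeting [O] is not contained in [E N], by the contradiction hypothesis. *)
have : dense (\bigcap_N (~` (E N `&` closure O))).
  apply: hilbert_Baire => N; split.
    by apply: closed_openC; apply: closedI => //; exact: closed_closure.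
  move=> S [s Ss] oS.
  have [[p [Sp Op]]|SO] := pselect (S `&` O !=set0).
    have [q [[Sq Oq] nEq]] : exists q, (S `&` O) q /\ ~ E N q.
      apply: contrapT => nq; apply: noO'; exists N, (S `&` O); split.
      - exact: openI.
      - by exists p.
      - by move=> q [].
      - move=> u n SOu Nn; have Eu : E N u.
          by apply: contrapT => nE; apply: nq; exists u.
        exact: Eu.
    by exists q; split=> // -[].
  exists s; split=> // -[_ clOs]; apply: SO.
  have [q [Oq Sq]] := clOs S (open_nbhs_nbhs (conj oS Ss)).
  by exists q.
move=> /(_ O O0 oO)[u [Ou Du]].
have [l ql] := quot_cvg b u.
have e2 : 0 < e / 2 by rewrite divr_gt0.
have [N _ NP] := near_dist ql e2.
apply: (Du N I); split; last exact: subset_closure.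
move=> n Nn; rewrite -[quot b n u - _](subrKA l) (le_trans (ler_normD _ _))//.
by rewrite (distrC l) [e]splitr lerD// NP//=.
Qed.

(** One slope [a] serves all base points [p] of the ball, so that moves in different directions can
    be chained. *)
Let linear_on b e r u (a : V) := forall p t, ball u r p ->
  ball u r (p + t *: b) -> `|F (p + t *: b) - F p - t *: a| <= e * `|t|.

Let quot_linear b e r u a N : 0 < e ->
  (forall q n, ball u r q -> (N <= n)%N -> `|quot b n q - a| <= e) ->
  linear_on b (2 * e) r u a.
Proof.
move=> e0 qe.
have main p t : 0 <= t -> ball u r p -> ball u r (p + t *: b) ->
    `|F (p + t *: b) - F p - t *: a| <= 2 * e * t.
  move=> t0 up upt; set w := F _ - _ - _.
  have [->|wN0] := eqVneq w 0; first by rewrite normr0 !mulr_ge0// ltW.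
  have w0 : 0 < `|w| by rewrite normr_gt0.
  (* Pairing with the error vector [w] itself turns the vector estimate into a scalar one, which at
     s = t compares the square of its norm with its norm. The slope 2e against an error of at most e
     per unit step makes [psi] strictly decrease over a step of length 1/(n+1). *)
  pose psi s := inner (F (p + s *: b) - s *: a) w - 2 * e * `|w| * s.
  have : psi t <= psi 0.
    apply: descent_le => // [|s /andP[s0 st]].
      apply: continuous_subspaceT => s; apply: cvgB.
        apply: cvg_inner; last exact: cvg_cst.
        apply: cvgB; last by apply: cvgZr_tmp; exact: cvg_id.
        apply: continuous_comp; last exact: F_cont.
        by apply: cvgD; [exact: cvg_cst|apply: cvgZr_tmp; exact: cvg_id].
      by apply: cvgMl_tmp; exact: cvg_id.
    have ts0 : 0 < t - s by rewrite subr_gt0.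
    have [M _ MP] := near_dist (@cvg_harmonic R) ts0.
    pose n := maxn N M; pose k : R := n.+1%:R^-1.
    have k0 : 0 < k by rewrite invr_gt0.
    have kts : k <= t - s.
      have /(_ (leq_maxr _ _)) := MP n.
      by rewrite /= subr0 ger0_norm// ltW.
    have us : ball u r (p + s *: b) 
      by apply: ball_segment up upt; rewrite s0 ltW.
    exists (s + k); first by rewrite ltrDl k0 -lerBrDl.
    have : k * inner (quot b n (p + s *: b) - a) w <= k * (e * `|w|).
      rewrite ler_pM2l// (le_trans (inner_ler _ _))// ler_wpM2r//.
      by apply: qe => //; exact: leq_maxl.
    have -> : k * inner (quot b n (p + s *: b) - a) w
        = inner (F (p + (s + k) *: b) - F (p + s *: b) - k *: a) w.
      rewrite -innerZl scalerBr scalerA mulVf ?scale1r ?pnatr_eq0//.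
      by rewrite scalerDl addrA.
    rewrite /psi !innerE => h.
    have : 0 < k * (e * `|w|) by rewrite !mulr_gt0.
    by move: h; lra.
  rewrite /psi scale0r addr0 scale0r subr0 mulr0 subr0 => psi_le.
  rewrite -(ler_pM2r w0) -expr2 normr_inner.
  move: psi_le; rewrite {3}/w !innerE; lra.
move=> p t up upt; have [t0|t0] := leP 0 t.
  by rewrite (ger0_norm t0) main.
(* For negative [t] the segment is traversed from its other end. *)
have := main (p + t *: b) (- t); rewrite oppr_ge0 (ltW t0) scaleNr addrK.
move=> /(_ isT upt up); rewrite ltr0_norm// -normrN.
by rewrite scaleNr opprK opprD opprB.
Qed.

Let linear_somewhere b (e : R) (O : set U) : 0 < e -> open O -> O !=set0 ->
  exists u r a, [/\ 0 < r, ball u r `<=` O & linear_on b e r u a].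
Proof.
move=> e0 oO O0; have e4 : 0 < e / 4 by rewrite divr_gt0.
have [N [S [oS [u Su] SO Se]]] := quot_stable b e4 oO O0.
have near_u : \forall q \near u, `|quot b N q - quot b N u| <= e / 4.
  by apply: near_dist => //; exact: quot_continuous.
have : nbhs u (S `&` [set q | `|quot b N q - quot b N u| <= e / 4]).
  by apply: filterI => //; exact: open_nbhs_nbhs.
move=> /nbhs_ballP[r /= r0 rP].
exists u, r, (quot b N u); split=> //; first by move=> q /rP[/SO].
(* One quarter bounds the drift of the quotients in the index, one their variation around [u];
   [quot_linear] doubles the sum. *)
have -> : e = 2 * (e / 4 + e / 4) by field.
apply: (@quot_linear _ _ _ _ _ N) => [|q n /rP[Sq qu] Nn].
  by rewrite addr_gt0.
rewrite -[_ - quot b N u](subrKA (quot b N q)) (le_trans (ler_normD _ _))//.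
by rewrite lerD// Se.
Qed.

Let linear_near b e u :=
  exists r a, 0 < r /\ linear_on b e r u a.

Let linear_near_open b e : open [set u | linear_near b e u].
Proof.
rewrite openE => u [r [a [r0 ua]]]; apply/nbhs_ballP; exists (r / 2) => /=.
  by rewrite divr_gt0.
move=> q uq; exists (r / 2), a; split; first by rewrite divr_gt0.
have sub p : ball q (r / 2) p -> ball u r p by exact: ball_split.
by move=> p t /sub qp /sub qpt; exact: ua.
Qed.

Let linear_near_dense b e : 0 < e -> dense [set u | linear_near b e u].
Proof.
move=> e0 O O0 oO; have [u [r [a [r0 uO ua]]]] := linear_somewhere b e0 oO O0.
by exists u; split; [apply: uO; exact: ballxx|exists r, a].
Qed.

(* Moving along the edges of a coordinate box turns uniform directional
   estimates in a basis into an estimate in all directions. *)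
Let differentiable_linear_near n (b w : 'I_n -> U) u :
  (forall v, v = \sum_(i < n) inner (w i) v *: b i) ->
  (forall i k, linear_near (b i) (k.+1%:R^-1) u) -> differentiable F u.
Proof.
move=> vE ulin.
have /choice[a aP] (i : 'I_n) : exists a : V, quot (b i) ^~ u @ \oo --> a.
  exact: quot_cvg.
(* The slope [c] supplied at precision 1/(k+1) depends on k. It is close to the directional
   derivative [a i] at [u], which can therefore replace it at every precision. *)
have ulin' i e : 0 < e ->
    \forall r \near (0 : R)^'+, linear_on (b i) e r u (a i).
  move=> e0; have e2 : 0 < e / 2 by rewrite divr_gt0.
  have [k _ kP] := near_dist (@cvg_harmonic R) e2.
  have ke : k.+1%:R^-1 <= e / 2.
    by have := kP k (leqnn _); rewrite /= subr0 ger0_norm// invr_ge0.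
  have [r [c [r0 rc]]] := ulin i k.
  have ac : `|a i - c| <= e / 2.
    have cvg_ac : (fun m => `|quot (b i) m u - c|) @ \oo --> `|a i - c|.
      by apply: cvg_norm; apply: cvgB; [exact: aP|exact: cvg_cst].
    apply: (cvg_ler cvg_ac).
    have cvg_b : (fun m => u + m.+1%:R^-1 *: b i) @ \oo --> u.
      rewrite -[X in _ --> X]addr0; apply: cvgD; first exact: cvg_cst.
      rewrite -(scale0r (b i)); apply: cvgZr_tmp; exact: cvg_harmonic.
    have : \forall m \near \oo, ball u r (u + m.+1%:R^-1 *: b i).
      exact: (cvg_b _ (nbhsx_ballx _ _ r0)).
    apply: filterS => m um.
    have m0 : 0 < m.+1%:R^-1 :> R by rewrite invr_gt0.
    have := rc _ _ (ballxx _ r0) um; rewrite ger0_norm ?(ltW m0)//.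
    move=> h; have -> : quot (b i) m u - c = m.+1%:R *:
        (F (u + m.+1%:R^-1 *: b i) - F u - m.+1%:R^-1 *: c).
      by rewrite [RHS]scalerBr scalerA mulfV ?scale1r.
    rewrite normrZ ger0_norm// (le_trans _ ke)// -ler_pdivlMl//.
    by rewrite mulrC.
  near=> s; move=> p t up upt.
  have sr : s <= r by near: s; exact: nbhs_right_le.
  have := rc p t (le_ball sr up) (le_ball sr upt).
  rewrite -[_ - t *: a i](subrKA (t *: c)) => h.
  rewrite (le_trans (ler_normD _ _))// -scalerBr normrZ (distrC c).
  rewrite [e]splitr mulrDl lerD//.
    by rewrite (le_trans h)// ler_wpM2r.
  by rewrite mulrC ler_wpM2r.
have lin_A : linear (fun v => \sum_(i < n) inner (w i) v *: a i).
  move=> k x y; rewrite scaler_sumr -big_split; apply: eq_bigr => i _ /=.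
  by rewrite !innerE scalerDl scalerA.
suff : diff_along (nbhs u) id u F (F u) (hom_of lin_A) by move=> /diff_alongP[].
move=> e e0.
(* [M] bounds the sum of the absolute coordinates of a vector relative to its norm, and [B] the
   length of the path along the edges, which must stay in the ball of radius [r]. *)
pose M := 1 + \sum_(i < n) `|w i|; pose B := 1 + \sum_(i < n) `|w i| * `|b i|.
have M0 : 0 < M by rewrite ltr_pwDl// sumr_ge0.
have B0 : 0 < B by rewrite ltr_pwDl// sumr_ge0// => i _; rewrite mulr_ge0.
have eM : 0 < e / M by rewrite divr_gt0.
have : \forall r \near (0 : R)^'+, 0 < r /\
    forall i, linear_on (b i) (e / M) r u (a i).
  near=> r; split; first by near: r; exact: nbhs_right_gt.
  by near: r; apply: filter_forall => i; exact: ulin'.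
move=> /filter_ex[r [r0 rP]].
have rB : 0 < r / B by rewrite divr_gt0.
apply/nbhs_ballP; exists (r / B) => //= v uv.
have vr : `|v - u| * B < r.
  by move: uv; rewrite -ball_normE/= distrC -ltr_pdivlMr.
set x := v - u in vr *.
have path (s : seq 'I_n) p :
    `|p - u| + \sum_(i <- s) `|w i| * `|b i| * `|x| < r ->
    `|F (p + \sum_(i <- s) inner (w i) x *: b i) - F p
       - \sum_(i <- s) inner (w i) x *: a i|
    <= e / M * \sum_(i <- s) `|inner (w i) x|.
  elim: s p => [|i s ih] p.
    by rewrite !big_nil !addr0 !subrr normr0 mulr0.
  rewrite !big_cons => pr.
  have up' : `|p + inner (w i) x *: b i - u|
      <= `|p - u| + `|w i| * `|b i| * `|x|.
    rewrite addrAC (le_trans (ler_normD _ _))// lerD2l normrZ mulrAC.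
    by rewrite ler_wpM2r// inner_le.
  have sum_ge0 : 0 <= \sum_(j <- s) `|w j| * `|b j| * `|x|.
    by apply: sumr_ge0 => j _; rewrite !mulr_ge0.
  have wbx0 : 0 <= `|w i| * `|b i| * `|x| by rewrite !mulr_ge0.
  have := ih (p + inner (w i) x *: b i).
  have -> : `|p + inner (w i) x *: b i - u|
    + \sum_(j <- s) `|w j| * `|b j| * `|x| < r by move: pr up'; lra.
  move=> /(_ isT) ih'.
  have step : `|F (p + inner (w i) x *: b i) - F p - inner (w i) x *: a i|
      <= e / M * `|inner (w i) x|.
    by apply: rP; rewrite -ball_normE/= distrC; move: pr up'; lra.
  rewrite mulrDr; apply: le_trans (lerD step ih').
  apply: le_trans (ler_normD _ _).
  rewrite le_eqVlt; apply/orP; left; apply/eqP; congr (`|_|).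
  by rewrite addrA [RHS]addrACA [X in _ = X + _]addrC subrKA -opprD.
rewrite hom_ofE -/x.
have := path (index_enum 'I_n) u; rewrite subrr normr0 add0r -vE.
rewrite /x (addrC u) subrK -/x => h; apply: (le_trans (h _)).
  rewrite -mulr_suml mulrC (le_lt_trans _ vr)// ler_wpM2l//.
  by rewrite /B lerDr.
rewrite -mulrA ler_wpM2l ?(ltW e0)// ler_pdivrMl//.
rewrite mulrC /M (@le_trans _ _ (`|x| * \sum_(i < n) `|w i|))//.
  rewrite mulr_sumr; apply: ler_sum => i _.
  by rewrite mulrC inner_le.
by rewrite ler_wpM2l// lerDr.
Unshelve. all: by end_near. Qed.

Lemma dense_differentiable u (r : R) : 0 < r ->
  exists2 p, ball u r p & differentiable F p.
Proof.
move=> r0; have [n [b [w vE]]] := dual_basis U.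
(* Baire needs a sequence: the pairs (direction, precision) are enumerated by decoding naturals, and
   codes of no pair get the whole space. *)
pose O j := oapp (fun ik : 'I_n * nat =>
  [set u | linear_near (b ik.1) ik.2.+1%:R^-1 u]) setT (unpickle j).
have : dense (\bigcap_j O j).
  apply: hilbert_Baire => j; rewrite /O; case: unpickle => [[i k]|]; split.
  - exact: linear_near_open.
  - by apply: linear_near_dense; rewrite invr_gt0.
  - exact: openT.
  - by move=> S [s Ss] _; exists s.
move=> /(_ (ball u r)) []; first by exists u; exact: ballxx.
  exact: ball_open.
move=> p [up Op]; exists p => //.
apply: (differentiable_linear_near vE) => i k.
by have := Op (pickle (i, k)) I; rewrite /O pickleK.
Qed.

End DenseDifferentiability.

(** * Bouligand subdifferential and semismoothness *)

Section Bouligand.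
Context {R : realType} {U V : hilbertType R} (F : U -> V) (L : R).
Hypothesis F_lip : forall u v, `|F u - F v| <= L * `|u - v|.
Hypothesis F_ss : forall u, semismooth F u.

Lemma lipschitz_fun_continuous : continuous F.
Proof.
move=> u; apply/cvgrPdist_le => e e0.
have L0 : 0 < 1 + `|L| by rewrite ltr_pwDl.
have e1 : 0 < (1 + `|L|)^-1 * e by rewrite mulr_gt0// invr_gt0.
have : \forall v \near u, `|v - u| <= (1 + `|L|)^-1 * e.
  by apply: near_dist => //; exact: cvg_id.
apply: filterS => v; rewrite ler_pdivlMl// distrC; apply: le_trans.
by rewrite (le_trans (F_lip _ _))// ler_wpM2r// (le_trans (ler_norm L))// lerDr.
Qed.

Lemma jac_lipschitz p v : differentiable F p -> `|jac F p v| <= L * `|v|.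
Proof.
move=> dF; have L0 : 0 <= L * `|v|.
  by have := F_lip v 0; rewrite subr0; exact: le_trans.
have [->|vN0] := eqVneq v 0; first by rewrite linear0 !normr0 mulr0.
have v0 : 0 < `|v| by rewrite normr_gt0.
apply/ler_addgt0Pr => e e0.
have ev : 0 < e / `|v| by rewrite divr_gt0.
have uv : (fun t : R => p + t *: v) @ (0 : R)^'+ --> p.
  rewrite -[X in _ --> X]addr0 -(scale0r v); apply: cvgD; first exact: cvg_cst.
  by apply: cvgZr_tmp; apply: cvg_at_right_filter; exact: cvg_id.
have Ft : \forall t \near (0 : R)^'+,
    `|F (p + t *: v) - F p - jac F p (p + t *: v - p)|
      <= e / `|v| * `|p + t *: v - p|.
  exact: differentiable_along dF uv _ ev.
have [t [/= {}Ft t0]] := filter_ex (filterI Ft (nbhs_right_gt 0)).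
rewrite (addrC p) addrK in Ft.
have := F_lip (t *: v + p) p; rewrite addrK.
move: Ft; rewrite linearZ normrZ (gtr0_norm t0) mulrCA divfK ?gt_eqF// => Ft Fl.
rewrite -(ler_pM2l t0) -[X in X * `|_|](gtr0_norm t0) -normrZ.
rewrite -[t *: _](subKr (F (t *: v + p) - F p)) (le_trans (ler_normB _ _))//.
by rewrite mulrDr; move: Ft Fl; lra.
Qed.

Lemma Bsubdiff_lipschitz u W v : Bsubdiff F u W -> `|W v| <= L * `|v|.
Proof.
move=> [p [dF _ pW]]; apply: (@cvg_ler _ _ \oo _ (fun k => `|jac F (p k) v|)).
  by apply: cvg_norm; have /op_cvgP := pW; exact.
by apply: nearW => k; exact: jac_lipschitz.
Qed.

(** Replacing sequences by an approximation at every scale makes closedness a triangle inequality,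
    for limits along any proper filter. *)
Lemma BsubdiffP u W : Bsubdiff F u W <-> forall e, 0 < e ->
  exists p, [/\ differentiable F p, `|p - u| <= e &
    forall v, `|jac F p v - W v| <= e * `|v|].
Proof.
split=> [[p [dF pu pW]] e e0|FW].
  have [k [/= k1 k2]] := filter_ex (filterI (near_dist pu e0) (pW _ e0)).
  by exists (p k).
have /choice[p pP] (k : nat) : exists p, [/\ differentiable F p,
    `|p - u| <= k.+1%:R^-1 & forall v, `|jac F p v - W v| <= k.+1%:R^-1 * `|v|].
  by apply: FW; rewrite invr_gt0.
have inv_le e : 0 < e -> \forall k \near \oo, k.+1%:R^-1 <= e :> R.
  move=> e0; apply: filterS (near_dist (@cvg_harmonic R) e0) => k.
  by rewrite /= subr0 ger0_norm// invr_ge0.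
exists p; split; first by move=> k; have [] := pP k.
  apply/cvgrPdistC_le => e /inv_le; apply: filterS => k.
  by apply: le_trans; have [] := pP k.
move=> e /inv_le; apply: filterS => k ke v; have [_ _ /(_ v)] := pP k.
by move=> /le_trans; apply; rewrite ler_wpM2r.
Qed.

Lemma Bsubdiff_closed T (G : set_system T) {GG : ProperFilter G}
    (u : T -> U) u0 (W : T -> 'Hom(U, V)) W0 :
  u @ G --> u0 -> op_cvg G W W0 -> (forall t, Bsubdiff F (u t) (W t)) ->
  Bsubdiff F u0 W0.
Proof.
move=> uu0 WW0 FW; apply/BsubdiffP => e e0.
have e2 : 0 < e / 2 by rewrite divr_gt0.
have [t [/= ut Wt]] := filter_ex (filterI (near_dist uu0 e2) (WW0 _ e2)).
have /BsubdiffP/(_ _ e2)[p [dF pu pW]] := FW t.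
exists p; split=> // [|v].
  rewrite -[p - u0](subrKA (u t)) (le_trans (ler_normD _ _))//.
  by rewrite [e]splitr lerD.
rewrite -[_ - W0 v](subrKA (W t v)) (le_trans (ler_normD _ _))//.
by rewrite [e]splitr mulrDl lerD.
Qed.

(** Jacobians at differentiability points approaching [u] are bounded by [L], hence converge along
    an ultrafilter; [BsubdiffP] turns this limit into a sequential one. *)
Lemma Bsubdiff_nonempty u : exists W, Bsubdiff F u W.
Proof.
have /choice[p pP] (k : nat) :
    exists p, ball u k.+1%:R^-1 p /\ differentiable F p.
  have k0 : 0 < k.+1%:R^-1 :> R by rewrite invr_gt0.
  have [|p up dF] :=
      @dense_differentiable _ _ _ F lipschitz_fun_continuous _ u _ k0.
    by move=> v; have [] := F_ss v.
  by exists p.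
have [G [GU sG]] := @ultraFilterLemma nat \oo _.
have [|W pW] := @bounded_ultra_op_cvg _ _ _ _ G _ (fun k => jac F (p k)) L.
  by move=> k v; apply: jac_lipschitz; exact: (pP k).2.
exists W; apply/BsubdiffP => e e0.
have ke : G [set k | k.+1%:R^-1 <= e].
  apply: sG; apply: filterS (near_dist (@cvg_harmonic R) e0) => k.
  by rewrite /= subr0 ger0_norm// invr_ge0.
have [k [/= ke' pWk]] := filter_ex (filterI ke (pW _ e0)).
exists (p k); split=> //; first exact: (pP k).2.
by have := (pP k).1; rewrite -ball_normE/= distrC => /ltW/le_trans; apply.
Qed.

(** The definition follows one sequence of operators at a time; applied to a sequence of
    counterexamples, it gives an estimate uniform over all elements of the subdifferential. *)
Lemma semismooth_near u e : 0 < e -> \forall p \near u,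
  forall W, Bsubdiff F p W -> `|F p - F u - W (p - u)| <= e * `|p - u|.
Proof.
move=> e0; apply: contrapT => nearN.
have /choice[pW pWP] (k : nat) : exists pW : U * 'Hom(U, V),
    [/\ ball u k.+1%:R^-1 pW.1, Bsubdiff F pW.1 pW.2 &
      ~ `|F pW.1 - F u - pW.2 (pW.1 - u)| <= e * `|pW.1 - u|].
  apply: contrapT => kN; apply: nearN; apply/nbhs_ballP.
  exists k.+1%:R^-1 => [|p up W FW]; first by rewrite /= invr_gt0.
  by apply: contrapT => Ne; apply: kN; exists (p, W).
have pu : (fun k => (pW k).1) @ \oo --> u.
  apply/cvgrPdist_le => d d0.
  apply: filterS (near_dist (@cvg_harmonic R) d0) => k.
  rewrite /= subr0 ger0_norm ?invr_ge0//; apply: le_trans; apply: ltW.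
  by have [] := pWP k; rewrite -ball_normE.
(* A single element is a one-term convex combination. *)
have clk k : clarke F (pW k).1 (pW k).2.
  exists 1%N, (fun=> 1), (fun=> (pW k).2); split=> // [|_|].
  - by rewrite big_ord1.
  - by have [] := pWP k.
  - by rewrite big_ord1 scale1r.
have [_ /(_ _ _ pu clk)/eqoP/(_ e e0)[N _ NP]] := F_ss u.
by have [_ _] := pWP N; apply; exact: (NP N (leqnn N)).
Qed.

(* Along an ultrafilter the elements of the Bouligand subdifferential converge,
   and by semismoothness their limit acts as a derivative. *)
Lemma Bsubdiff_along T (G : set_system T) {GG : UltraFilter G}
    (u : T -> U) u0 (W : T -> 'Hom(U, V)) :
  u @ G --> u0 -> (forall t, Bsubdiff F (u t) (W t)) ->
  exists W0, [/\ Bsubdiff F u0 W0, op_cvg G W W0 &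
    diff_along G u u0 (fun t => F (u t)) (F u0) W0].
Proof.
move=> uu0 FW.
have [W0 WW0] := bounded_ultra_op_cvg (fun t v => Bsubdiff_lipschitz v (FW t)).
exists W0; split=> //; first exact: Bsubdiff_closed WW0 FW.
move=> e e0; have e2 : 0 < e / 2 by rewrite divr_gt0.
have ss : \forall t \near G, forall W, Bsubdiff F (u t) W ->
    `|F (u t) - F u0 - W (u t - u0)| <= e / 2 * `|u t - u0|.
  exact: (uu0 _ (semismooth_near u0 e2)).
apply: filterS2 ss (WW0 _ e2) => t /(_ _ (FW t)) st Wt.
rewrite -[_ - W0 _](subrKA (W t (u t - u0))) (le_trans (ler_normD _ _))//.
by rewrite [e]splitr mulrDl lerD.
Qed.

End Bouligand.

(** * Gradients of the Lagrangians *)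

Section ProductComponents.
Context {R : realType} {U V : hilbertType R}.

Definition fst_hom : 'Hom(hprod U V, U) := row_op \1 0.
Definition snd_hom : 'Hom(hprod U V, V) := row_op 0 \1.

Lemma fst_homE y : fst_hom y = y.1.
Proof. by rewrite row_opE id_lfunE zero_lfunE addr0. Qed.

Lemma snd_homE y : snd_hom y = y.2.
Proof. by rewrite row_opE id_lfunE zero_lfunE add0r. Qed.

Lemma hprod_normE (y : hprod U V) : `|y| ^+ 2 = `|y.1| ^+ 2 + `|y.2| ^+ 2.
Proof. by rewrite !normr_inner. Qed.

Lemma snd_norm_le (y : hprod U V) : `|y.2| <= `|y|.
Proof. by rewrite -ler_sqr ?nnegrE// hprod_normE lerDr sqr_ge0. Qed.

Lemma hprod_norm_le (y : hprod U V) : `|y| <= `|y.1| + `|y.2|.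
Proof.
rewrite -ler_sqr ?nnegrE ?addr_ge0// hprod_normE sqrrD.
by rewrite -addrA lerD2l lerDr mulrn_wge0// mulr_ge0.
Qed.

Lemma cvg_hprod T (F : set_system T) {FF : Filter F} (a : T -> U) (b : T -> V)
    a0 b0 : a @ F --> a0 -> b @ F --> b0 ->
  (fun t => (a t, b t) : hprod U V) @ F --> ((a0, b0) : hprod U V).
Proof.
move=> aa0 bb0; apply/cvgrPdistC_le => e e0.
have e2 : 0 < e / 2 by rewrite divr_gt0.
apply: filterS2 (near_dist aa0 e2) (near_dist bb0 e2) => t at0 bt.
by rewrite (le_trans (hprod_norm_le _))// [e]splitr lerD.
Qed.

Lemma cvg_hprod1 T (F : set_system T) {FF : Filter F} (y : T -> hprod U V)
    (y0 : hprod U V) : y @ F --> y0 -> (fun t => (y t).1) @ F --> y0.1.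
Proof.
have -> : (fun t => (y t).1) = (fun t => fst_hom (y t)).
  by apply/funext => t; rewrite fst_homE.
by rewrite -fst_homE; exact: cvg_hom.
Qed.

Lemma cvg_hprod2 T (F : set_system T) {FF : Filter F} (y : T -> hprod U V)
    (y0 : hprod U V) : y @ F --> y0 -> (fun t => (y t).2) @ F --> y0.2.
Proof.
have -> : (fun t => (y t).2) = (fun t => snd_hom (y t)).
  by apply/funext => t; rewrite snd_homE.
by rewrite -snd_homE; exact: cvg_hom.
Qed.

Context {T : Type} {F : set_system T} {FF : Filter F}.
Context {S : hilbertType R} (s : T -> S) (s0 : S).
Implicit Types (a : T -> hprod U V) (A : 'Hom(S, hprod U V)).

Lemma diff_along_fst a (a0 : hprod U V) A : diff_along F s s0 a a0 A ->
  diff_along F s s0 (fun t => (a t).1) a0.1 (fst_hom \o A)%VF.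
Proof.
move=> /(diff_along_lin fst_hom); rewrite fst_homE.
by have -> : (fun t => fst_hom (a t)) = (fun t => (a t).1)
  by apply/funext => t; rewrite fst_homE.
Qed.

Lemma diff_along_snd a (a0 : hprod U V) A : diff_along F s s0 a a0 A ->
  diff_along F s s0 (fun t => (a t).2) a0.2 (snd_hom \o A)%VF.
Proof.
move=> /(diff_along_lin snd_hom); rewrite snd_homE.
by have -> : (fun t => snd_hom (a t)) = (fun t => (a t).2)
  by apply/funext => t; rewrite snd_homE.
Qed.

Lemma diff_along_pair (a : T -> U) (b : T -> V) (a0 : U) (b0 : V)
    (A : 'Hom(S, U)) (B : 'Hom(S, V)) :
  diff_along F s s0 a a0 A -> diff_along F s s0 b b0 B ->
  diff_along F s s0 (fun t => (a t, b t) : hprod U V) (a0, b0) (col_op A B).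
Proof.
move=> aA bB e e0; have e2 : 0 < e / 2 by rewrite divr_gt0.
apply: filterS2 (aA _ e2) (bB _ e2) => t At Bt; rewrite col_opE.
rewrite (le_trans (hprod_norm_le _))// [e]splitr mulrDl.
by apply: lerD; [exact: At|exact: Bt].
Qed.

End ProductComponents.

Section LagrangianGradients.
Context {R : realType} {X Z : hilbertType R} {m : nat}.
Variables (f : X -> R) (h : X -> euclid R m) (g : X -> Z) (K : set Z).
Hypotheses (f_C2 : C2 (f : X -> R^o)) (h_C2 : C2 h) (g_C2 : C2 g).
Hypothesis K_dual : self_dual K.
Local Notation Y := (hprod (euclid R m) Z).
Local Notation P := (metric_proj K).
Implicit Types (x : X) (y : Y) (c : R).

Lemma C2_diff_along (U V : hilbertType R) (F : U -> V) u : C2 F ->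
  diff_along (nbhs u) id u F (F u) (jac F u).
Proof.
move=> [F1 _]; apply: differentiable_along; first exact: (F1 u).1.
exact: cvg_id.
Qed.

Lemma C2_op_cvg_adjoint (U V : hilbertType R) (F : U -> V) T
    (G : set_system T) {GG : Filter G} (u : T -> U) u0 : C2 F -> u @ G --> u0 ->
  op_cvg G (fun t => adjoint (jac F (u t))) (adjoint (jac F u0)).
Proof.
move=> [F1 _] uu0; apply: op_cvg_adjoint.
exact: (op_cvg_comp (F1 u0).2 uu0).
Qed.

Lemma diff_along_grad (phi : X -> R^o) x w (A : 'Hom(X, R^o)) :
  diff_along (nbhs x) id x phi (phi x) A ->
  (forall v, A v = inner w v) -> grad phi x = w.
Proof.
by move=> /diff_alongP[_ jA] Aw; apply: grad_eq => v; rewrite jA.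
Qed.

Lemma grad_lagrangianE x y : grad_lagrangian f h g x y =
  grad (f : X -> R^o) x - adjoint (jac h x) y.1 - adjoint (jac g x) y.2.
Proof.
pose A : 'Hom(X, R^o) := jac (f : X -> R^o) x
  - (inner_hom y.1 \o jac h x)%VF - (inner_hom y.2 \o jac g x)%VF.
apply: (@diff_along_grad _ _ _ A) => [|v]; last first.
  rewrite /A !(add_lfunE, opp_lfunE) !comp_lfunE !inner_homE !innerE gradP.
  by rewrite !adjointPr.
have -> : (fun x' => lagrangian f h g x' y) = (fun x' =>
    (f x' : R^o) - inner_hom y.1 (h x') - inner_hom y.2 (g x')).
  by apply/funext => x'; rewrite !inner_homE.
rewrite /lagrangian -(inner_homE y.1) -(inner_homE y.2).
apply: diff_alongB; first apply: diff_alongB.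
- exact: C2_diff_along.
- by apply: diff_along_lin; exact: C2_diff_along.
- by apply: diff_along_lin; exact: C2_diff_along.
Qed.

Lemma grad_lagrangianB x y y0 : grad_lagrangian f h g x y =
  grad_lagrangian f h g x y0 - adjoint (jac h x) (y.1 - y0.1)
    - adjoint (jac g x) (y.2 - y0.2).
Proof.
rewrite !grad_lagrangianE (linearB (adjoint (jac h x))).
rewrite (linearB (adjoint (jac g x))) !opprB.
rewrite [X in _ = X + _]addrAC [X in _ = X - _ + _]addrA subrK.
by rewrite addrA subrK.
Qed.

Definition shifted c x y : Z := y.2 - c *: g x.

(* The multiplier (lambda_c, mu_c) of the context, at an arbitrary point x. *)
Definition mult_update c x y : Y := (y.1 - c *: h x, P (shifted c x y)).

(** The squared norm of the projection is differentiable even where the projection is not, with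
    gradient [2 *: P]; this is what turns the penalty terms into the updated multiplier. *)
Lemma auglag_along c x y : c != 0 ->
  diff_along (nbhs x) id x (fun x' => auglag f h g K c x' y : R^o)
    (auglag f h g K c x y)
    (inner_hom (grad_lagrangian f h g x (mult_update c x y))).
Proof.
move=> c0.
pose B : 'Hom(X, Z) := - (c *: jac g x).
pose A : 'Hom(X, R^o) := jac (f : X -> R^o) x - (inner_hom y.1 \o jac h x)%VF
  + (c / 2) *: (inner_hom (2 *: h x) \o jac h x)%VF
  + (2 * c)^-1 *: ((inner_hom (2 *: P (shifted c x y)) \o B)%VF - 0).
have -> : inner_hom (grad_lagrangian f h g x (mult_update c x y)) = A.
  apply/lfunP => v; rewrite inner_homE grad_lagrangianE.
  rewrite /A /B !(add_lfunE, opp_lfunE, scale_lfunE, zero_lfunE).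
  rewrite !comp_lfunE !inner_homE !(opp_lfunE, scale_lfunE) subr0 !innerE gradP.
  rewrite !adjointPr !innerE.
  by rewrite /GRing.scale /=; field.
have hx := C2_diff_along x h_C2; have gx := C2_diff_along x g_C2.
have cid : (id : X -> X) @ nbhs x --> x by exact: cvg_id.
have ux : diff_along (nbhs x) id x (fun x' => shifted c x' y) (shifted c x y) B.
  rewrite /B -[- _]add0r; apply: diff_alongB; first exact: diff_along_cst.
  exact: diff_alongZ.
rewrite /auglag -!(inner_homE y.1).
have -> : (fun x' => f x' - inner y.1 (h x') + c / 2 * `|h x'| ^+ 2 +
    (2 * c)^-1 * (`|P (y.2 - c *: g x')| ^+ 2 - `|y.2| ^+ 2)) = (fun x' =>
   (f x' : R^o) - inner_hom y.1 (h x') + (c / 2) *: (`|h x'| ^+ 2 : R^o) +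
    (2 * c)^-1 *: ((`|P (shifted c x' y)| ^+ 2 : R^o) - `|y.2| ^+ 2)).
  by apply/funext => x'; rewrite !inner_homE.
apply: diff_alongD; first apply: diff_alongD.
- apply: diff_alongB; first exact: C2_diff_along.
  exact: diff_along_lin.
- by apply: diff_alongZ; exact: diff_along_sqr.
- apply: diff_alongZ; apply: diff_alongB; last exact: diff_along_cst.
  apply: diff_along_comp (ux) _ => e e0.
  have := metric_proj_sqr_diff K_dual (shifted c x y) e0.
  exact: (diff_along_cvg cid ux).
Qed.

Lemma grad_auglagE c x y : c != 0 ->
  grad_auglag f h g K c x y = grad_lagrangian f h g x (mult_update c x y).
Proof.
move=> c0; apply: diff_along_grad (auglag_along x y c0) _ => v.
by rewrite inner_homE.
Qed.

Lemma grad_lagrangian_differentiable x y :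
  differentiable (fun x' => grad_lagrangian f h g x' y) x.
Proof.
under eq_fun do rewrite grad_lagrangianE.
apply: differentiableB; first apply: differentiableB.
- exact: C2_adjoint_differentiable.
- exact: C2_adjoint_differentiable.
- exact: C2_adjoint_differentiable.
Qed.

(* Derivative of (x, y) |-> grad_auglag c x y when W is used as a derivative of
   the projection. *)
Definition grad_auglag_der c x y (W : 'End(Z)) : 'Hom(hprod X Y, X) :=
  row_op (calA f h g c x (mult_update c x y) W)
    (- row_op (adjoint (jac h x)) (adjoint (jac g x) \o W)%VF).

(** Freezing the multiplier at its limit value [z0] splits the gradient into a term differentiable
    in x and two terms linear in the deviation of the multiplier from [z0]. The latter fall under
    [diff_along_op_cvg], where [W] is the only derivative of the projection involved. *)
Lemma grad_auglag_along T (F : set_system T) {FF : Filter F}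
    (s : T -> hprod X Y) x0 y0 c W :
  c != 0 -> s @ F --> ((x0, y0) : hprod X Y) ->
  let u t := shifted c (s t).1 (s t).2 in
  diff_along F u (shifted c x0 y0) (fun t => P (u t)) (P (shifted c x0 y0)) W ->
  diff_along F s (x0, y0) (fun t => grad_auglag f h g K c (s t).1 (s t).2)
    (grad_auglag f h g K c x0 y0) (grad_auglag_der c x0 y0 W).
Proof.
move=> c0 ss0 u uW; pose s0 : hprod X Y := (x0, y0).
pose z t := mult_update c (s t).1 (s t).2; pose z0 := mult_update c x0 y0.
have sid : diff_along F s s0 s s0 \1%VF.
  move=> e e0; apply: nearW => t.
  by rewrite id_lfunE subrr normr0 mulr_ge0// ltW.
have xs := diff_along_fst (FF := FF) sid.
have y1s := diff_along_fst (FF := FF) (diff_along_snd (FF := FF) sid).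
have y2s := diff_along_snd (FF := FF) (diff_along_snd (FF := FF) sid).
have xx0 : (fun t => (s t).1) @ F --> x0 by exact: diff_along_cvg ss0 xs.
have hs := diff_along_comp_differentiable (GG := FF) ss0 xs (h_C2.1 x0).1.
have gs := diff_along_comp_differentiable (GG := FF) ss0 xs (g_C2.1 x0).1.
have Ls := diff_along_comp_differentiable (GG := FF) ss0 xs
  (grad_lagrangian_differentiable x0 z0).
have z1s := diff_alongB (FF := FF) y1s (diff_alongZ (FF := FF) c hs).
have us := diff_alongB (FF := FF) y2s (diff_alongZ (FF := FF) c gs).
have z2s := diff_along_comp (FF := FF) us uW.
have hz := diff_along_op_cvg (FF := FF)
  (C2_op_cvg_adjoint (GG := FF) h_C2 xx0) z1s.
have gz := diff_along_op_cvg (FF := FF)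
  (C2_op_cvg_adjoint (GG := FF) g_C2 xx0) z2s.
have := diff_alongB (FF := FF) (diff_alongB (FF := FF) Ls hz) gz.
rewrite !subr0 -grad_auglagE//.
have -> : (fun t => grad_auglag f h g K c (s t).1 (s t).2) = (fun t =>
    grad_lagrangian f h g (s t).1 z0
    - adjoint (jac h (s t).1) ((s t).2.1 - c *: h (s t).1 - z0.1)
    - adjoint (jac g (s t).1) (P (u t) - z0.2)).
  by apply/funext => t; rewrite grad_auglagE// (grad_lagrangianB _ _ z0).
congr diff_along; apply/lfunP => -[dx dy].
rewrite /grad_auglag_der /calA row_opE.
rewrite !(add_lfunE, opp_lfunE, scale_lfunE, comp_lfunE, id_lfunE) row_opE.
rewrite !(add_lfunE, opp_lfunE, scale_lfunE, comp_lfunE, id_lfunE).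
rewrite !(fst_homE, snd_homE) /= row_opE comp_lfunE !zero_lfunE !addr0.
rewrite (linearB (adjoint (jac h x0))) (linearB W).
rewrite (linearB (adjoint (jac g x0))) !linearZ/= !scalerN !opprB.
by rewrite [X in X + _ = _]addrA [LHS]addrACA -opprD.
Qed.

Lemma shifted_cvg T (F : set_system T) {FF : Filter F} (x : T -> X)
    (y : T -> Y) x0 y0 c : x @ F --> x0 -> y @ F --> y0 ->
  (fun t => shifted c (x t) (y t)) @ F --> shifted c x0 y0.
Proof.
move=> xx0 yy0; apply: cvgB; first exact: cvg_hprod2.
apply: cvgZl_tmp; apply: diff_along_cvg (xx0) _.
exact: differentiable_along (g_C2.1 x0).1 xx0.
Qed.

Lemma mult_update_cvg T (F : set_system T) {FF : Filter F} (x : T -> X)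
    (y : T -> Y) x0 y0 c : x @ F --> x0 -> y @ F --> y0 ->
  (fun t => mult_update c (x t) (y t)) @ F --> mult_update c x0 y0.
Proof.
move=> xx0 yy0; apply: cvg_hprod.
  apply: cvgB; first exact: cvg_hprod1.
  apply: cvgZl_tmp; apply: diff_along_cvg (xx0) _.
  exact: differentiable_along (h_C2.1 x0).1 xx0.
apply: continuous_cvg; last exact: shifted_cvg.
apply: (@lipschitz_fun_continuous _ _ _ _ 1) => u v.
by rewrite mul1r metric_proj_lipschitz.
Qed.

Lemma grad_auglag_cvg T (F : set_system T) {FF : Filter F} (x : T -> X)
    (y : T -> Y) x0 y0 c : c != 0 -> x @ F --> x0 -> y @ F --> y0 ->
  (fun t => grad_auglag f h g K c (x t) (y t)) @ F
    --> grad_auglag f h g K c x0 y0.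
Proof.
move=> c0 xx0 yy0.
have zz0 : (fun t => mult_update c (x t) (y t)) @ F --> mult_update c x0 y0.
  exact: mult_update_cvg.
rewrite grad_auglagE// grad_lagrangianE.
under eq_cvg do rewrite grad_auglagE// grad_lagrangianE.
apply: cvgB; first apply: cvgB.
- by apply: diff_along_cvg (xx0) _; apply: differentiable_along => //;
    exact: C2_adjoint_differentiable.
- apply: op_cvg_apply; first exact: C2_op_cvg_adjoint.
  exact: (cvg_hprod1 zz0).
- apply: op_cvg_apply; first exact: C2_op_cvg_adjoint.
  exact: (cvg_hprod2 zz0).
Qed.

Lemma calA_cvg T (F : set_system T) {FF : Filter F} (x : T -> X)
    (y : T -> Y) (W : T -> 'End(Z)) x0 y0 W0 c :
  x @ F --> x0 -> y @ F --> y0 -> op_cvg F W W0 ->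
  op_cvg F (fun t => calA f h g c (x t) (y t) (W t)) (calA f h g c x0 y0 W0).
Proof.
move=> xx0 yy0 WW0; apply/op_cvgP => d.
(* The Hessian of the Lagrangian is affine in the multiplier, so joint continuity reduces to that of
   three adjoint terms. *)
have jacE x' y' : jac (fun x => grad_lagrangian f h g x y') x' d =
    jac (fun x => adjoint (jac (f : X -> R^o) x) (1 : R^o)) x' d
    - jac (fun x => adjoint (jac h x) y'.1) x' d
    - jac (fun x => adjoint (jac g x) y'.2) x' d.
  have dA (V : hilbertType R) (F' : X -> V) v : C2 F' ->
      diff_along (nbhs x') id x' (fun x => adjoint (jac F' x) v)
        (adjoint (jac F' x') v) (jac (fun x => adjoint (jac F' x) v) x').
    move=> F2; apply: (differentiable_along _ (@cvg_id _ _)).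
    exact: C2_adjoint_differentiable.
  have df := dA R^o f (1 : R^o) f_C2; have dh := dA (euclid R m) h y'.1 h_C2.
  have dg := dA Z g y'.2 g_C2.
  have dL := diff_alongB (FF := nbhs_filter x')
    (diff_alongB (FF := nbhs_filter x') df dh) dg.
  have {}dL := diff_along_eq dL (fun x1 => esym (grad_lagrangianE x1 y'))
    (esym (grad_lagrangianE x' y')).
  have [_ jL] := diff_alongP dL.
  have subE (A B C : 'Hom(X, X)) : (A - B - C) d = A d - B d - C d.
    by rewrite !(add_lfunE, opp_lfunE).
  exact: etrans (congr1 (fun A : 'Hom(X, X) => A d) jL) (subE _ _ _).
have Jh := op_cvg_comp (FF := FF) (h_C2.1 x0).2 xx0.
have Jg := op_cvg_comp (FF := FF) (g_C2.1 x0).2 xx0.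
have y1 : (fun t => (y t).1) @ F --> y0.1 by exact: cvg_hprod1.
have y2 : (fun t => (y t).2) @ F --> y0.2 by exact: cvg_hprod2.
rewrite /calA !(add_lfunE, scale_lfunE, comp_lfunE) jacE.
under eq_cvg do rewrite !(add_lfunE, scale_lfunE, comp_lfunE) jacE.
apply: cvgD; first apply: cvgD; first apply: cvgB; first apply: cvgB.
- by apply: C2_adjoint_jac_cvg => //; exact: cvg_cst.
- exact: C2_adjoint_jac_cvg.
- exact: C2_adjoint_jac_cvg.
- apply: cvgZl_tmp; apply: op_cvg_apply; first exact: C2_op_cvg_adjoint.
  by move/op_cvgP : Jh; exact.
- apply: cvgZl_tmp; apply: op_cvg_apply; first exact: C2_op_cvg_adjoint.
  by apply: op_cvg_apply WW0 _; move/op_cvgP : Jg; exact.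
Qed.

End LagrangianGradients.

(** * The second-order method of multipliers *)

Section LocallyLipschitz.
Context {R : realType} {U V : hilbertType R}.
Implicit Types F : U -> V.

Lemma locally_lipschitz_at F (A : set U) y : open A -> A y ->
  [locally [lipschitz F x | x in A]] ->
  exists2 M, 0 < M & \forall y' \near y, `|F y' - F y| <= M * `|y' - y|.
Proof.
move=> oA Ay F_lip.
have /pinfty_ex_gt0[M M0 MP] := F_lip (y, y) (conj Ay Ay); exists M => //.
have [[B1 B2] /= [yB1 yB2] BP] := MP.
have nearA : nbhs y A by apply: open_nbhs_nbhs; split.
apply: filterS2 yB1 nearA => y' y'B1 Ay'.
exact: (BP (y', y) (conj y'B1 (nbhs_singleton yB2)) (conj Ay' Ay)).
Qed.

Lemma lipschitz_at_cvg F y M : 0 < M ->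
  (\forall y' \near y, `|F y' - F y| <= M * `|y' - y|) ->
  F y' @[y' --> y] --> F y.
Proof.
move=> M0 FM; apply/cvgrPdistC_le => e e0.
have e1 : 0 < M^-1 * e by rewrite mulr_gt0// invr_gt0.
have : \forall y' \near y, `|y' - y| <= M^-1 * e.
  by apply: near_dist => //; exact: cvg_id.
apply: filterS2 FM => y' /le_trans + ey; apply.
by rewrite -ler_pdivlMl.
Qed.

End LocallyLipschitz.

Section PrimalMinimizers.
Context {R : realType} {X Z : hilbertType R} {m : nat}.
Variables (f : X -> R) (h : X -> euclid R m) (g : X -> Z) (K : set Z).
Hypotheses (f_C2 : C2 (f : X -> R^o)) (h_C2 : C2 h) (g_C2 : C2 g).
Hypothesis K_dual : self_dual K.
Hypothesis P_ss : forall z, semismooth (metric_proj K) z.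
Local Notation Y := (hprod (euclid R m) Z).
Local Notation P := (metric_proj K).
Variables (c : R) (xs : X) (ys : Y) (eps delta0 : R) (xc : Y -> X).
Hypothesis c_gt0 : 0 < c.
Hypothesis xcP : primal_minimizers f h g K c xs ys eps delta0 xc.
Hypothesis xsP : multipliers f h g K xs ys.
Implicit Types (x : X) (y : Y).
Local Notation G := (grad_auglag f h g K c).
Local Notation A x y := (calA f h g c x (mult_update h g K c x y)).

Let c_neq0 : c != 0. Proof. by rewrite gt_eqF. Qed.

Lemma metric_proj_lip1 u v : `|P u - P v| <= 1 * `|u - v|.
Proof. by rewrite mul1r metric_proj_lipschitz. Qed.

Lemma grad_auglag_diff x y : differentiable P (shifted g c x y) ->
  differentiable (fun p : hprod X Y => G p.1 p.2) ((x, y) : hprod X Y) /\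
  jac (fun p : hprod X Y => G p.1 p.2) ((x, y) : hprod X Y)
    = grad_auglag_der f h g K c x y (jac P (shifted g c x y)).
Proof.
move=> dP; pose p0 : hprod X Y := (x, y); apply: diff_alongP.
apply: (grad_auglag_along (FF := nbhs_filter p0)
  f_C2 h_C2 g_C2 K_dual c_neq0 (@cvg_id _ _)).
apply: differentiable_along => //.
have c1 : (fun p : hprod X Y => p.1) @ nbhs p0 --> x.
  have := @cvg_hprod1 _ _ _ _ _ _ id _ (@cvg_id _ (nbhs p0)); exact.
have c2 : (fun p : hprod X Y => p.2) @ nbhs p0 --> y.
  have := @cvg_hprod2 _ _ _ _ _ _ id _ (@cvg_id _ (nbhs p0)); exact.
exact: (shifted_cvg g_C2 c1 c2).
Qed.

Lemma grad_auglag_der_cvg T (F : set_system T) {FF : Filter F} x0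
    (y : T -> Y) (W : T -> 'End(Z)) y0 W0 :
  y @ F --> y0 -> op_cvg F W W0 ->
  op_cvg F (fun t => grad_auglag_der f h g K c x0 (y t) (W t))
    (grad_auglag_der f h g K c x0 y0 W0).
Proof.
move=> yy0 WW0; have zz0 : (fun t => mult_update h g K c x0 (y t)) @ F
    --> mult_update h g K c x0 y0.
  by apply: mult_update_cvg => //; exact: cvg_cst.
have AA0 : op_cvg F (fun t => A x0 (y t) (W t)) (A x0 y0 W0).
  by apply: calA_cvg => //; exact: cvg_cst.
apply/op_cvgP => -[dx dy].
rewrite /grad_auglag_der row_opE opp_lfunE row_opE comp_lfunE.
under eq_cvg do rewrite row_opE opp_lfunE row_opE comp_lfunE.
apply: cvgD; first by move/op_cvgP : AA0; exact.
apply: cvgN; apply: cvgD; first exact: cvg_cst.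
by apply: cvg_hom; move/op_cvgP : WW0; exact.
Qed.

(* Moving y alone already reaches all the differentiability points of P near
   the shifted point, so every element of its Bouligand subdifferential occurs
   in that of the joint gradient. *)
Lemma grad_auglag_Bsubdiff x y W : Bsubdiff P (shifted g c x y) W ->
  Bsubdiff (fun p : hprod X Y => G p.1 p.2) ((x, y) : hprod X Y)
    (grad_auglag_der f h g K c x y W).
Proof.
move=> [u [dP uu uW]].
pose yk k : Y := (y.1, u k + c *: g x).
have ukE k : shifted g c x (yk k) = u k by rewrite /shifted addrK.
have yky : yk @ \oo --> y.
  have -> : y = (y.1, shifted g c x y + c *: g x).
    by rewrite subrK; case: (y).
  by apply: cvg_hprod; [exact: cvg_cst|apply: cvgD => //; exact: cvg_cst].
exists (fun k => (x, yk k)); split.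
- move=> k; have [] // := @grad_auglag_diff x (yk k).
  by rewrite ukE.
- by apply: cvg_hprod => //; exact: cvg_cst.
- have -> : (fun k => jac (fun p : hprod X Y => G p.1 p.2) (x, yk k)) =
      (fun k => grad_auglag_der f h g K c x (yk k) (jac P (u k))).
    apply/funext => k; have [|_ ->] := @grad_auglag_diff x (yk k).
      by rewrite ukE.
    by rewrite ukE.
  exact: grad_auglag_der_cvg.
Qed.

(** A(W) is the x-block of [grad_auglag_der], which belongs to the joint subdifferential covered by
    [primal_minimizers]. *)
Lemma calA_posdef x y W : ball xs eps x -> ball ys delta0 y ->
  Bsubdiff P (shifted g c x y) W -> posdef (A x y W).
Proof.
move=> bx by0 /grad_auglag_Bsubdiff HW; have [_ _ _ pd _] := xcP.
move=> d dN0; have := pd x y bx by0 _ HW d dN0.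
by rewrite comp_lfunE col_opE row_opE id_lfunE !zero_lfunE linear0 addr0.
Qed.

Lemma local_min_grad (phi : X -> R^o) x w :
  diff_along (nbhs x) id x phi (phi x) (inner_hom w) ->
  (\forall x' \near x, phi x <= phi x') -> w = 0.
Proof.
move=> dphi phi_min; apply/eqP; rewrite -normr_eq0; apply/negPn/negP => wN0.
have w0 : 0 < `|w| by rewrite lt0r wN0 normr_ge0.
have w2 : 0 < `|w| / 2 by rewrite divr_gt0.
have xt : (fun t : R => x - t *: w) @ (0 : R)^'+ --> x.
  rewrite -[X in _ --> X]subr0 -(scale0r w); apply: cvgB; first exact: cvg_cst.
  by apply: cvgZr_tmp; apply: cvg_at_right_filter; exact: cvg_id.
have h1 : \forall t \near (0 : R)^'+, phi x <= phi (x - t *: w).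
  exact: xt _ phi_min.
have h2 : \forall t \near (0 : R)^'+, `|phi (x - t *: w) - phi x
    - inner_hom w (x - t *: w - x)| <= `|w| / 2 * `|x - t *: w - x|.
  exact: xt _ (dphi _ w2).
have h3 : \forall t \near (0 : R)^'+, 0 < t by exact: nbhs_right_gt.
have [t [[/= h1t h2t] t0]] := filter_ex (filterI (filterI h1 h2) h3).
move: h2t; rewrite inner_homE (addrC x) addrK normrN normrZ (gtr0_norm t0).
rewrite innerNr innerZr -normr_inner => /(le_trans (ler_norm _)).
rewrite (addrC _ x) opprK.
have : 0 < t * `|w| ^+ 2 by rewrite mulr_gt0// exprn_gt0.
have -> : `|w| / 2 * (t * `|w|) = t * `|w| ^+ 2 / 2 by field.
by move: h1t; lra.
Qed.

Lemma grad_auglag_xc y : ball ys delta0 y -> G (xc y) y = 0.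
Proof.
move=> yb; have [_ _ _ _ /(_ y yb)[xb xmin]] := xcP.
rewrite grad_auglagE//.
apply: local_min_grad (auglag_along f_C2 h_C2 g_C2 K_dual (xc y) y c_neq0) _.
have : \forall x' \near xc y, ball xs eps x'.
  by apply: open_nbhs_nbhs; split => //; exact: ball_open.
apply: filterS => x' x'b; have [->//|x'N] := eqVneq x' (xc y).
exact/ltW/xmin.
Qed.

(** Complementarity is Moreau's decomposition of the shifted point: [ys.2] and [c *: g xs] are
    orthogonal elements of [K], so the projection of their difference is [ys.2]. *)
Lemma mult_update_star : mult_update h g K c xs ys = ys.
Proof.
have [_ hx Kg Ky yg] := xsP.
rewrite /mult_update hx scaler0 subr0 (@metric_proj_eq _ _ _ _ _ ys.2)//.
- by case: (ys).
- by rewrite /shifted subKr; apply: self_dualZ => //; exact: ltW.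
- by rewrite /shifted subKr innerZl innerC yg mulr0.
Qed.

Lemma grad_auglag_star : G xs ys = 0.
Proof. by rewrite grad_auglagE// mult_update_star; have [] := xsP. Qed.


Lemma ultra_at_right0 :
  exists2 F : set_system R, UltraFilter F & (0 : R)^'+ `<=` F.
Proof.
have [F [FU sF]] := @ultraFilterLemma R (0 : R)^'+ (at_right_proper_filter 0).
by exists F.
Qed.

(* By semismoothness the increment of G along d is, up to o(t), the image of
   t d under an operator A x y W, which is positive definite. *)
Lemma grad_auglag_increases x d (T : R) : d != 0 -> ball xs eps x -> 0 < T ->
  exists2 t, 0 < t <= T & inner (G x ys) d < inner (G (x + t *: d) ys) d.
Proof.
move=> dN0 xb T0; have [[eps0 delta00] _ _ _ _] := xcP.
have d0 : 0 < `|d| by rewrite normr_gt0.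
have [F FU sF] := ultra_at_right0.
pose s t : hprod X Y := (x + t *: d, ys).
have xt : (fun t => x + t *: d) @ F --> x.
  rewrite -[X in _ --> X]addr0 -(scale0r d); apply: cvgD; first exact: cvg_cst.
  apply: cvgZr_tmp => B B0; apply: sF.
  have : nbhs (0 : R) [set t | 0 < t -> B t] by apply: filterS B0 => t Bt _.
  exact.
have ss0 : s @ F --> ((x, ys) : hprod X Y).
  by apply: cvg_hprod => //; exact: cvg_cst.
have uu0 : (fun t => shifted g c (s t).1 (s t).2) @ F --> shifted g c x ys.
  by apply: shifted_cvg => //; exact: cvg_cst.
have /choice[W WP] t : exists W, Bsubdiff P (shifted g c (s t).1 (s t).2) W.
  exact: Bsubdiff_nonempty metric_proj_lip1 P_ss _.
have [W0 [W0P _ dW0]] := Bsubdiff_along metric_proj_lip1 P_ss uu0 WP.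
have Apos := calA_posdef xb (ballxx _ delta00) W0P dN0.
set a := inner d _ in Apos.
(* With this tolerance the error, once paired with [d], is at most a t / 2: half of the main term a
   t. *)
have e0 : 0 < a / (2 * `|d| ^+ 2) by rewrite divr_gt0// mulr_gt0// exprn_gt0.
have dG : \forall t \near F, `|G (s t).1 (s t).2 - G x ys
    - grad_auglag_der f h g K c x ys W0 (s t - ((x, ys) : hprod X Y))|
    <= a / (2 * `|d| ^+ 2) * `|s t - ((x, ys) : hprod X Y)|.
  exact: (grad_auglag_along f_C2 h_C2 g_C2 K_dual c_neq0 ss0 dW0).
have tpos : F [set t : R | 0 < t] by apply: sF; exact: nbhs_right_gt.
have tT : F [set t : R | t <= T] by apply: sF; exact: nbhs_right_le.
have [t [[/= dGt t0] tT']] := filter_ex (filterI (filterI dG tpos) tT).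
exists t; first by rewrite t0.
have sE : s t - ((x, ys) : hprod X Y) = (t *: d, 0).
  by rewrite /s; congr (_, _) => /=; rewrite ?subrr// (addrC x) addrK.
rewrite sE in dGt.
have nE : `|((t *: d, 0) : hprod X Y)| = t * `|d|.
  apply/eqP; rewrite -(eqrXn2 (_ : 0 < 2)%N)// ?mulr_ge0 ?(ltW t0)//.
  by rewrite hprod_normE/= normr0 expr0n addr0 normrZ (gtr0_norm t0).
rewrite nE /grad_auglag_der row_opE opp_lfunE row_opE /= in dGt.
rewrite !linear0 addr0 subr0 in dGt.
have := inner_le (G (x + t *: d) ys - G x ys - A x ys W0 (t *: d)) d.
have : `|G (x + t *: d) ys - G x ys - A x ys W0 (t *: d)| * `|d|
    <= a / (2 * `|d| ^+ 2) * (t * `|d|) * `|d| by rewrite ler_wpM2r.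
have -> : a / (2 * `|d| ^+ 2) * (t * `|d|) * `|d| = a * t / 2.
  by field; rewrite gt_eqF.
move=> h1 /le_trans/(_ h1); rewrite ler_norml => /andP[+ _].
have -> : A x ys W0 (t *: d) = t *: A x ys W0 d by rewrite linearZ.
rewrite !innerE (innerC (A x ys W0 d)) -/a.
have ta0 : 0 < t * a by rewrite mulr_gt0.
have lin (p q : R) : - (a * t / 2) <= p - q - t * a -> q < p by lra.
exact: lin.
Qed.

Lemma xc_star : xc ys = xs.
Proof.
have [[eps0 delta00] _ _ _ /(_ ys (ballxx _ delta00))[xb _]] := xcP.
apply/eqP/negPn/negP => xcN; pose d := xc ys - xs.
have dN0 : d != 0 by rewrite subr_eq0.
have xcE : xs + 1 *: d = xc ys by rewrite scale1r addrC subrK.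
pose psi t := inner (G (xs + t *: d) ys) d.
have in_ball s : 0 <= s <= 1 -> ball xs eps (xs + s *: d).
  move=> s01; apply: ball_segment (ballxx _ eps0) _; first exact: s01.
  by rewrite xcE.
have inc s : 0 <= s < 1 -> exists2 s', s < s' <= 1 & psi s < psi s'.
  move=> /andP[s0 s1].
  have sT : 0 < 1 - s by rewrite subr_gt0.
  have [|t /andP[t0 t1] lt] := grad_auglag_increases dN0 (in_ball s _) sT.
    by rewrite s0 ltW.
  exists (s + t); first by rewrite ltrDl t0 -lerBrDl.
  by rewrite /psi scalerDl addrA.
have psi_cont : continuous psi.
  move=> s; apply: cvg_inner; last exact: cvg_cst.
  apply: (grad_auglag_cvg f_C2 h_C2 g_C2 K_dual) => //; last exact: cvg_cst.
  by apply: cvgD; [exact: cvg_cst|apply: cvgZr_tmp; exact: cvg_id].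
have psi1 : psi 1 = 0.
  by rewrite /psi xcE grad_auglag_xc ?inner0l//; exact: ballxx.
have psi0 : psi 0 = 0.
  by rewrite /psi scale0r addr0 grad_auglag_star inner0l.
have [|s /andP[s0 s1]] := inc 0; first by rewrite lexx ltr01.
rewrite psi0 => psis.
(* Once positive at [s], [psi] cannot come back to 0 at 1: a larger value to the right of each
   point, with continuity, gives psi s <= psi 1. *)
have : - psi 1 <= - psi s.
  apply: (@descent_le _ (fun t => - psi t)) => // [|t /andP[st t1]].
    by apply: continuous_subspaceT => t; apply: cvgN; exact: psi_cont.
  have [|t' tt' lt] := inc t; first by rewrite (le_trans (ltW s0))//.
  by exists t'; rewrite ?ltrN2.
by rewrite psi1 lerN2 leNgt psis.
Qed.

(** * Gradient of the dual function *)

Definition dual_grad x y : Y :=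
  (- h x, c^-1 *: (P (shifted g c x y) - y.2)).

Lemma shiftedB x y y' : shifted g c x y' - shifted g c x y = y'.2 - y.2.
Proof. by rewrite /shifted opprB addrA subrK. Qed.

Let auglagB x y y' : auglag f h g K c x y' - auglag f h g K c x y =
  inner (- h x) (y'.1 - y.1) + (2 * c)^-1 *
    (`|P (shifted g c x y')| ^+ 2 - `|P (shifted g c x y)| ^+ 2
     - 2 * inner y.2 (y'.2 - y.2) - `|y'.2 - y.2| ^+ 2).
Proof.
rewrite /auglag -/(shifted g c x y) -/(shifted g c x y').
rewrite (normr_inner (y'.2 - y.2)) !innerE (innerC (h x)) (innerC (h x) y.1).
rewrite (innerC y'.2 y.2) -!normr_inner.
by field.
Qed.

Let inner_dual_grad x y y' : inner (dual_grad x y) (y' - y) =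
  inner (- h x) (y'.1 - y.1) + (2 * c)^-1 *
    (2 * inner (P (shifted g c x y)) (y'.2 - y.2)
     - 2 * inner y.2 (y'.2 - y.2)).
Proof.
transitivity (inner (- h x) (y'.1 - y.1)
  + inner (c^-1 *: (P (shifted g c x y) - y.2)) (y'.2 - y.2)) => //.
by rewrite innerZl (innerBl (P _)); congr (_ + _); field.
Qed.

(** At fixed x, [dual_grad x y] is the gradient of [auglag] in y, and this is its concavity
    inequality: the quadratic remainder in the bound on the projection is exactly cancelled by the
    term in the squared norm of the multiplier. *)
Lemma auglag_dual_le x y y' :
  auglag f h g K c x y' - auglag f h g K c x y
    <= inner (dual_grad x y) (y' - y).
Proof.
rewrite auglagB inner_dual_grad lerD2l ler_pM2l ?invr_gt0 ?mulr_gt0//.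
have := metric_proj_sqr_le K_dual (shifted g c x y) (shifted g c x y').
by rewrite shiftedB; lra.
Qed.

Lemma auglag_dual_ge x y y' :
  inner (dual_grad x y) (y' - y) - (2 * c)^-1 * `|y' - y| ^+ 2
    <= auglag f h g K c x y' - auglag f h g K c x y.
Proof.
rewrite auglagB inner_dual_grad -addrA lerD2l -mulrBr.
rewrite ler_pM2l ?invr_gt0 ?mulr_gt0//.
have := metric_proj_sqr_ge K_dual (shifted g c x y) (shifted g c x y').
rewrite shiftedB.
have : `|y'.2 - y.2| ^+ 2 <= `|y' - y| ^+ 2.
  by rewrite ler_sqr ?nnegrE//; exact: (snd_norm_le (y' - y)).
by lra.
Qed.

Lemma xc_lipschitz_at y : ball ys delta0 y ->
  exists2 M, 0 < M & \forall y' \near y, `|xc y' - xc y| <= M * `|y' - y|.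
Proof.
have [_ xc_lip _ _ _] := xcP.
by move=> yb; apply: locally_lipschitz_at xc_lip => //; exact: ball_open.
Qed.

Lemma xc_cvg y : ball ys delta0 y -> xc y' @[y' --> y] --> xc y.
Proof. by move=> /xc_lipschitz_at[M M0]; exact: lipschitz_at_cvg. Qed.

Lemma dual_grad_cvg T (F : set_system T) {FF : Filter F} (x : T -> X)
    (y : T -> Y) x0 y0 : x @ F --> x0 -> y @ F --> y0 ->
  (fun t => dual_grad (x t) (y t)) @ F --> dual_grad x0 y0.
Proof.
move=> xx0 yy0; apply: cvg_hprod.
  apply: cvgN; apply: diff_along_cvg (xx0) _.
  exact: differentiable_along (h_C2.1 x0).1 xx0.
apply: cvgZl_tmp; apply: cvgB; last exact: cvg_hprod2.
apply: continuous_cvg; last exact: shifted_cvg.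
by apply: (@lipschitz_fun_continuous _ _ _ _ 1); exact: metric_proj_lip1.
Qed.

Lemma dual_funE y : ball ys delta0 y ->
  dual_fun f h g K c xs eps y = auglag f h g K c (xc y) y.
Proof.
move=> yb; have [_ _ _ _ /(_ y yb)[xb xmin]] := xcP.
have lb : lbound [set auglag f h g K c x y | x in ball xs eps]
    (auglag f h g K c (xc y) y).
  move=> _ [x xb' <-]; have [->//|xN] := eqVneq x (xc y).
  exact/ltW/xmin.
have in_set : [set auglag f h g K c x y | x in ball xs eps]
    (auglag f h g K c (xc y) y) by exists (xc y).
apply/eqP; rewrite eq_le; apply/andP; split.
  by apply: ge_inf => //; exists (auglag f h g K c (xc y) y).
by apply: lb_le_inf => //; exists (auglag f h g K c (xc y) y).
Qed.

(* Danskin's theorem: compare the minimal values at y and y' through the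
   minimizer of either of them. *)
Lemma dual_fun_along y : ball ys delta0 y ->
  diff_along (nbhs y) id y (dual_fun f h g K c xs eps : Y -> R^o)
    (dual_fun f h g K c xs eps y) (inner_hom (dual_grad (xc y) y)).
Proof.
move=> yb e e0; have e2 : 0 < e / 2 by rewrite divr_gt0.
have near_ball : \forall y' \near y, ball ys delta0 y'.
  by apply: open_nbhs_nbhs; split => //; exact: ball_open.
(* The lower estimate freezes the minimizer of y' but linearizes at y, whence this mixed gradient;
   continuity of [xc] makes it close to the one at y. *)
have Dcvg : (fun y' => dual_grad (xc y') y) @ nbhs y --> dual_grad (xc y) y.
  by apply: dual_grad_cvg; [exact: xc_cvg|exact: cvg_cst].
have ce : 0 < c * e by rewrite mulr_gt0.
(* The radius c e makes the quadratic remainder of [auglag_dual_ge] at most half of the tolerated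
   error. *)
have near_y : \forall y' \near y, `|y' - y| <= c * e.
  exact: (near_dist (@cvg_id _ (nbhs y)) ce).
have near_D := near_dist (FF := nbhs_filter y) Dcvg e2.
suff near_le : \forall y' \near y, `|(dual_fun f h g K c xs eps y' : R^o)
    - dual_fun f h g K c xs eps y
    - inner_hom (dual_grad (xc y) y) (y' - y)| <= e * `|y' - y|.
  by exact: near_le.
apply: filterS3 near_ball near_y near_D => y' y'b y'y Dy'.
have [_ _ _ _ xmin] := xcP.
have min_le z z' : ball ys delta0 z -> ball ys delta0 z' ->
    auglag f h g K c (xc z) z <= auglag f h g K c (xc z') z.
  move=> zb z'b; have [_ zmin] := xmin z zb; have [z'in _] := xmin z' z'b.
  by have [->//|N] := eqVneq (xc z') (xc z); exact/ltW/zmin.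
rewrite inner_homE !dual_funE//.
have up := le_trans (lerB (min_le y' y y'b yb) (lexx _))
  (auglag_dual_le (xc y) y y').
have lo := le_trans (auglag_dual_ge (xc y') y y')
  (lerB (lexx _) (min_le y y' yb y'b)).
have D1 : - (e / 2 * `|y' - y|) <= inner (dual_grad (xc y') y) (y' - y)
    - inner (dual_grad (xc y) y) (y' - y).
  rewrite -innerBl.
  have : `|inner (dual_grad (xc y') y - dual_grad (xc y) y) (y' - y)|
      <= e / 2 * `|y' - y|.
    by rewrite (le_trans (inner_le _ _))// ler_wpM2r.
  by rewrite ler_norml => /andP[].
have D2 : (2 * c)^-1 * `|y' - y| ^+ 2 <= e / 2 * `|y' - y|.
  rewrite expr2 mulrA ler_wpM2r// ler_pdivrMl ?mulr_gt0//.
  by rewrite (le_trans y'y)// le_eqVlt; apply/orP; left; apply/eqP; field.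
have fin (p q r s k : R) : p - q <= r -> s - k <= p - q ->
    - (e / 2 * `|y' - y|) <= s - r -> k <= e / 2 * `|y' - y| ->
    `|p - q - r| <= e * `|y' - y|.
  by move=> h1 h2 h3 h4; rewrite ler0_norm; [|move: h1]; lra.
exact: fin up lo D1 D2.
Qed.

Lemma grad_dual_fun y : ball ys delta0 y ->
  differentiable (dual_fun f h g K c xs eps : Y -> R^o) y /\
  grad (dual_fun f h g K c xs eps : Y -> R^o) y = dual_grad (xc y) y.
Proof.
move=> /dual_fun_along dphi; have [dif jE] := diff_alongP dphi; split=> //.
by apply: grad_eq => v; rewrite jE inner_homE.
Qed.

Lemma dual_grad_star : dual_grad (xc ys) ys = 0.
Proof.
have [_ hx _ _ _] := xsP.
rewrite xc_star /dual_grad hx oppr0.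
have -> : P (shifted g c xs ys) = ys.2.
  by have := congr1 snd mult_update_star.
by rewrite subrr scaler0.
Qed.

(* The element of V_c(y) given by W, with x in the place of xc y. *)
Definition newton_op x y (W : 'End(Z)) : 'End(Y) :=
  - (col_op (jac h x) (W \o jac g x) \o (A x y W)^-1
      \o row_op (adjoint (jac h x)) (adjoint (jac g x) \o W))%VF
  - col_op (row_op 0 0) (row_op 0 (c^-1 *: (\1%VF - W))).

Definition newton_primal x y (W : 'End(Z)) : 'Hom(Y, X) :=
  ((A x y W)^-1 \o row_op (adjoint (jac h x)) (adjoint (jac g x) \o W))%VF.

Lemma newton_primalE x y W v : newton_primal x y W v =
  (A x y W)^-1%VF (adjoint (jac h x) v.1 + adjoint (jac g x) (W v.2)).
Proof. by rewrite comp_lfunE row_opE comp_lfunE. Qed.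

Lemma newton_opE x y W v : newton_op x y W v =
  (- jac h x (newton_primal x y W v),
   - W (jac g x (newton_primal x y W v)) - c^-1 *: (v.2 - W v.2)).
Proof.
rewrite newton_primalE /newton_op add_lfunE !opp_lfunE !comp_lfunE !row_opE.
rewrite comp_lfunE !col_opE comp_lfunE !row_opE !zero_lfunE.
rewrite scale_lfunE add_lfunE opp_lfunE id_lfunE !add0r.
by congr (_, _) => /=; rewrite ?subr0.
Qed.

Lemma newton_op_cvg T (F : set_system T) {FF : Filter F} (x : T -> X)
    (y : T -> Y) (W : T -> 'End(Z)) x0 y0 W0 :
  x @ F --> x0 -> y @ F --> y0 -> op_cvg F W W0 -> lker (A x0 y0 W0) = 0%VS ->
  op_cvg F (fun t => newton_op (x t) (y t) (W t)) (newton_op x0 y0 W0).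
Proof.
move=> xx0 yy0 WW0 kA; apply/op_cvgP => v.
have zz0 : (fun t => mult_update h g K c (x t) (y t)) @ F
    --> mult_update h g K c x0 y0 by exact: mult_update_cvg.
have AA0 : op_cvg F (fun t => A (x t) (y t) (W t)) (A x0 y0 W0).
  exact: calA_cvg.
have Jh : op_cvg F (fun t => jac h (x t)) (jac h x0).
  exact: op_cvg_comp (h_C2.1 x0).2 xx0.
have Jg : op_cvg F (fun t => jac g (x t)) (jac g x0).
  exact: op_cvg_comp (g_C2.1 x0).2 xx0.
have Wv2 : (fun t => W t v.2) @ F --> W0 v.2 by move/op_cvgP : WW0; exact.
have pp0 : (fun t => newton_primal (x t) (y t) (W t) v) @ F
    --> newton_primal x0 y0 W0 v.
  rewrite newton_primalE; under eq_cvg do rewrite newton_primalE.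
  apply: op_cvg_apply; first exact: op_cvg_inv.
  have Jha : op_cvg F (fun t => adjoint (jac h (x t))) (adjoint (jac h x0)).
    exact: C2_op_cvg_adjoint.
  apply: cvgD; first by move/op_cvgP : Jha; exact.
  by apply: op_cvg_apply => //; exact: C2_op_cvg_adjoint.
rewrite newton_opE; under eq_cvg do rewrite newton_opE.
apply: cvg_hprod; first by apply: cvgN; exact: op_cvg_apply pp0.
apply: cvgB.
  by apply: cvgN; apply: op_cvg_apply WW0 _; exact: op_cvg_apply pp0.
by apply: cvgZl_tmp; apply: cvgB => //; exact: cvg_cst.
Qed.

Lemma calV_cP y V : calV_c f h g K c xc y V <->
  exists2 W, Bsubdiff P (shifted g c (xc y) y) W & V = newton_op (xc y) y W.
Proof. by []. Qed.

(** * Contraction of the Newton step *)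

Hypothesis V_neg : forall V, calV_c f h g K c xc ys V -> negdef V.

Lemma ball_delta0 : ball ys delta0 ys.
Proof. by have [[_ d0] _ _ _ _] := xcP; exact: ballxx. Qed.

Lemma ball_xc y : ball ys delta0 y -> ball xs eps (xc y).
Proof. by move=> yb; have [_ _ _ _ /(_ y yb)[]] := xcP. Qed.

Lemma posdef_lker (B : 'End(X)) : posdef B -> lker B = 0%VS.
Proof.
move=> Bpos; apply: lker0_injP => u Bu; apply/eqP/negPn/negP => uN0.
by have := Bpos u uN0; rewrite Bu inner0r ltxx.
Qed.

Lemma lker_calA y W : ball ys delta0 y -> Bsubdiff P (shifted g c (xc y) y) W ->
  lker (A (xc y) y W) = 0%VS.
Proof.
by move=> yb FW; apply: posdef_lker; exact: calA_posdef (ball_xc yb) yb FW.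
Qed.

Lemma lker_newton_op W : Bsubdiff P (shifted g c xs ys) W ->
  lker (newton_op xs ys W) = 0%VS.
Proof.
rewrite -{1}xc_star => FW; apply: lker0_injP => v Vv.
apply/eqP/negPn/negP => vN0.
have : inner v (newton_op (xc ys) ys W v) < 0.
  by apply: V_neg => //; apply/calV_cP; exists W.
by rewrite xc_star Vv inner0r ltxx.
Qed.

(** A property of one pair (y, W), so that its failures can be collected into a sequence; it covers
    every solution [dy] of the linear system. *)
Definition newton_contracts (r : R) y W : Prop :=
  lker (newton_op (xc y) y W) = 0%VS /\
  forall dy, dual_grad (xc y) y + newton_op (xc y) y W dy = 0 ->
    `|y + dy - ys| <= r * `|y - ys|.

Section Along.
Context {T : Type} {F : set_system T} {FU : UltraFilter F}.
Variables (y : T -> Y) (W : T -> 'End(Z)).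
Hypothesis y_cvg : y @ F --> ys.
Hypothesis y_ball : forall t, ball ys delta0 (y t).
Hypothesis W_sub : forall t, Bsubdiff P (shifted g c (xc (y t)) (y t)) (W t).
Local Notation x := (fun t => xc (y t)).

Lemma xc_along_cvg : x @ F --> xs.
Proof.
by rewrite -xc_star; apply: continuous_cvg y_cvg; exact: xc_cvg ball_delta0.
Qed.

(* Since G vanishes along (xc y, y), its linearization determines that of xc
   up to o(|y - ys|); the Lipschitz bound on xc absorbs the error in x. *)
Lemma xc_along W0 : Bsubdiff P (shifted g c xs ys) W0 ->
  diff_along F (fun t => shifted g c (x t) (y t)) (shifted g c xs ys)
    (fun t => P (shifted g c (x t) (y t))) (P (shifted g c xs ys)) W0 ->
  diff_along F y ys x xs (newton_primal xs ys W0).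
Proof.
move=> W0P dW0 e e0.
have kA : lker (A xs ys W0) = 0%VS.
  by have := @lker_calA ys W0 ball_delta0; rewrite xc_star; apply.
have [M M0 xM] := xc_lipschitz_at ball_delta0; rewrite xc_star in xM.
have near_x : \forall t \near F, `|x t - xs| <= M * `|y t - ys|.
  exact: y_cvg _ xM.
have [N N0 AN] := hom_bounded (A xs ys W0)^-1%VF.
(* [N] bounds the inverse of A(W0), and M + 1 the increment of the pair (x, y) relative to that of
   y. *)
pose k := e / (N * (M + 1)).
have k0 : 0 < k by rewrite divr_gt0// mulr_gt0// addr_gt0.
pose s t : hprod X Y := (x t, y t).
have ss0 : s @ F --> ((xs, ys) : hprod X Y).
  by apply: cvg_hprod => //; exact: xc_along_cvg.
have dG : \forall t \near F, `|G (x t) (y t) - G xs ys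
    - grad_auglag_der f h g K c xs ys W0 (s t - ((xs, ys) : hprod X Y))|
    <= k * `|s t - ((xs, ys) : hprod X Y)|.
  exact: (grad_auglag_along f_C2 h_C2 g_C2 K_dual c_neq0 ss0 dW0).
apply: filterS2 near_x dG => t xt; rewrite grad_auglag_xc// grad_auglag_star.
pose dx := x t - xs; pose dy := y t - ys.
have -> : s t - ((xs, ys) : hprod X Y) = (dx, dy) by [].
rewrite subr0 sub0r normrN row_opE opp_lfunE row_opE comp_lfunE /= -/dx -/dy.
pose b := adjoint (jac h xs) dy.1 + adjoint (jac g xs) (W0 dy.2).
rewrite -/b => dGt.
have -> : dx - newton_primal xs ys W0 dy
    = (A xs ys W0)^-1%VF (A xs ys W0 dx - b).
  have AK : (A xs ys W0)^-1%VF (A xs ys W0 dx) = dx.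
    by rewrite lker0_lfunK// kA.
  by rewrite newton_primalE -{1}AK -linearB.
rewrite (le_trans (AN _))// -ler_pdivlMl// (le_trans dGt)//.
have : `|((dx, dy) : hprod X Y)| <= (M + 1) * `|dy|.
  by rewrite (le_trans (hprod_norm_le _))//= mulrDl mul1r lerD2r.
rewrite -(ler_pM2l k0) => /le_trans; apply.
rewrite le_eqVlt; apply/orP; left; apply/eqP; rewrite /k; field.
by rewrite !gt_eqF// addr_gt0.
Qed.

Lemma newton_along : exists V0,
  [/\ lker V0 = 0%VS, op_cvg F (fun t => newton_op (x t) (y t) (W t)) V0 &
    diff_along F y ys (fun t => dual_grad (x t) (y t)) 0 V0].
Proof.
have u_cvg : (fun t => shifted g c (x t) (y t)) @ F --> shifted g c xs ys.
  by apply: shifted_cvg => //; exact: xc_along_cvg.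
have [W0 [W0P WW0 dW0]] := Bsubdiff_along metric_proj_lip1 P_ss u_cvg W_sub.
have kA : lker (A xs ys W0) = 0%VS.
  by have := @lker_calA ys W0 ball_delta0; rewrite xc_star; apply.
exists (newton_op xs ys W0); split; first exact: lker_newton_op.
  by apply: newton_op_cvg => //; exact: xc_along_cvg.
have FF : Filter F by exact: _.
have dx := xc_along W0P dW0.
have did : diff_along F y ys y ys \1%VF.
  move=> e e0; apply: nearW => t.
  by rewrite id_lfunE subrr normr0 mulr_ge0// ltW.
have dmu := diff_along_snd (FF := FF) did.
have dh := diff_along_comp_differentiable (GG := FF) y_cvg dx (h_C2.1 xs).1.
have dg := diff_along_comp_differentiable (GG := FF) y_cvg dx (g_C2.1 xs).1.
have du := diff_alongB (FF := FF) dmu (diff_alongZ (FF := FF) c dg).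
have dP := diff_along_comp (FF := FF) du dW0.
have dD := diff_along_pair (FF := FF) (diff_alongN (FF := FF) dh)
  (diff_alongZ (FF := FF) c^-1 (diff_alongB (FF := FF) dP dmu)).
rewrite -dual_grad_star xc_star.
set D1 := (X in diff_along _ _ _ _ _ X) in dD.
(* The chain rule gives [c^-1 *: (W0 (v.2 - c *: jac g xs p) - v.2)] as second component, with p the
   primal increment; the factor c cancels and the block of the method appears. *)
suff <- : D1 = newton_op xs ys W0 by exact: dD.
apply/lfunP => v; rewrite newton_opE /D1 col_opE.
congr (_, _); first by rewrite opp_lfunE comp_lfunE.
rewrite scale_lfunE add_lfunE opp_lfunE comp_lfunE add_lfunE opp_lfunE.
rewrite scale_lfunE !comp_lfunE snd_homE id_lfunE.
have -> (p q : Z) : W0 (p - c *: q) = W0 p - c *: W0 q.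
  by rewrite linearB linearZ.
rewrite !scalerBr scalerA mulVf// scale1r opprB.
by rewrite addrAC addrC.
Qed.

Lemma newton_near r : 0 < r ->
  \forall t \near F, newton_contracts r (y t) (W t).
Proof.
move=> r0; have [V0 [kV0 VV0 dD]] := newton_along.
have [k k0 kV] := op_cvg_bounded_below VV0 kV0.
have e0 : 0 < k * r / 2 by rewrite divr_gt0// mulr_gt0.
apply: filterS3 kV (VV0 _ e0) (dD _ e0) => t kVt VVt Dt.
rewrite /newton_contracts; set V := newton_op _ _ _.
split=> [|dy Vdy]; first exact: lker0_bounded_below k0 kVt.
rewrite -(ler_pM2l k0) (le_trans (kVt _))//.
(* The step satisfies V dy = - [dual_grad], so V applied to the new error splits into the deviation
   of V from [V0] and the linearization error of the dual gradient, each at most k r / 2 times the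
   old error. *)
have -> : V (y t + dy - ys) = (V (y t - ys) - V0 (y t - ys))
    - (dual_grad (x t) (y t) - 0 - V0 (y t - ys)).
  have -> : dual_grad (x t) (y t) = - V dy by apply/eqP; rewrite -addr_eq0 Vdy.
  by rewrite subr0 opprB opprK addrA subrK addrAC linearD.
rewrite (le_trans (ler_normB _ _))//.
have := lerD (VVt (y t - ys)) Dt; rewrite -mulrDl -splitr mulrA; exact.
Qed.

End Along.

Lemma newton_contraction (r : R) : 0 < r -> exists2 d, 0 < d &
  forall y, ball ys d y -> ball ys delta0 y /\
    forall W, Bsubdiff P (shifted g c (xc y) y) W -> newton_contracts r y W.
Proof.
move=> r0; apply: contrapT => noball.
have [[_ delta00] _ _ _ _] := xcP.
have /choice[yW yWP] (n : nat) : exists yW : Y * 'End(Z),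
    [/\ ball ys n.+1%:R^-1 yW.1, ball ys delta0 yW.1,
      Bsubdiff P (shifted g c (xc yW.1) yW.1) yW.2 & 
        ~ newton_contracts r yW.1 yW.2].
  apply: contrapT => nyW; apply: noball.
  (* The minimum with [delta0] keeps the points in the domain of [xc], so that only the contraction
     can fail; including W in the counterexample makes the radius uniform in W. *)
  exists (Num.min n.+1%:R^-1 delta0); first by rewrite lt_min invr_gt0 ltr0n.
  move=> y yb; have yb1 : ball ys n.+1%:R^-1 y.
    by apply: le_ball yb; rewrite ge_min lexx.
  have yb2 : ball ys delta0 y by apply: le_ball yb; rewrite ge_min lexx orbT.
  split=> // W WP; apply: contrapT => ngood.
  by apply: nyW; exists (y, W).
have [F [FU sF]] := @ultraFilterLemma nat \oo _.
have y_cvg : (fun n => (yW n).1) @ F --> ys.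
  apply/cvgrPdist_le => e e0; apply: sF.
  apply: filterS (near_dist (@cvg_harmonic R) e0) => n.
  rewrite /= subr0 ger0_norm ?invr_ge0//; apply: le_trans; apply: ltW.
  by have [] := yWP n; rewrite -ball_normE.
have y_ball n : ball ys delta0 (yW n).1 by have [] := yWP n.
have W_sub n : Bsubdiff P (shifted g c (xc (yW n).1) (yW n).1) (yW n).2.
  by have [] := yWP n.
have [n goodn] := filter_ex (newton_near y_cvg y_ball W_sub r0).
by have [_ _ _] := yWP n; apply.
Qed.

Lemma smm_step_well_definedP y : ball ys delta0 y ->
  (forall W, Bsubdiff P (shifted g c (xc y) y) W ->
     lker (newton_op (xc y) y W) = 0%VS) ->
  smm_step_well_defined f h g K c xc xs ys eps delta0 y.
Proof.
move=> yb kV; have [dphi _] := grad_dual_fun yb; split.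
- exact: yb.
- exact: dphi.
- by move=> W FW; exact: (lker_calA yb FW).
- have [W FW] := Bsubdiff_nonempty metric_proj_lip1 P_ss (shifted g c (xc y) y).
  by exists (newton_op (xc y) y W); apply/calV_cP; exists W.
- move=> V /calV_cP[W FW VE]; have kW : lker V = 0%VS by rewrite VE kV.
  move: (grad _ _) => b; exists (- V^-1%VF b); split=> [|dy bV].
    by rewrite linearN/= lker0_lfunVK ?kW// subrr.
  have -> : b = - V dy by apply/eqP; rewrite -addr_eq0 bV.
  by rewrite linearN/= opprK lker0_lfunK ?kW.
Qed.

Lemma smm_step_contraction r d y y' :
  (forall y, ball ys d y -> ball ys delta0 y /\
    forall W, Bsubdiff P (shifted g c (xc y) y) W -> newton_contracts r y W) ->
  ball ys d y -> smm_step f h g K c xc xs ys eps delta0 y y' ->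
  `|y' - ys| <= r * `|y - ys|.
Proof.
move=> dP yb [yb' [V [W FW VE] [dy Vdy ->]]].
have [_ /(_ W FW)[_]] := dP y yb; apply.
have [_ <-] := grad_dual_fun yb'.
by move: Vdy; rewrite VE.
Qed.

End PrimalMinimizers.

Theorem theorem3p6 (R : realType) (X Z : hilbertType R) (m : nat)
    (f : X -> R) (h : X -> euclid R m) (g : X -> Z) (K : set Z)
    (f_C2 : C2 (f : X -> R^o)) (h_C2 : C2 h) (g_C2 : C2 g)
    (K_self_dual : self_dual K)
    (PiK_semismooth : forall z, strongly_semismooth (metric_proj K) z)
    (xs : X) (ys : hprod (euclid R m) Z)
    (xs_stationary : multipliers f h g K xs ys)
    (cbar eta : R) (cbar_gt0 : 0 < cbar) (eta_gt0 : 0 < eta)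
    (asmA : assumptionA f h g K xs ys cbar eta)
    (eps delta0 : R -> R) (xc : R -> hprod (euclid R m) Z -> X)
    (xcP : forall c, cbar <= c ->
       primal_minimizers f h g K c xs ys (eps c) (delta0 c) (xc c))
    (asmB : assumptionB f h g K ys cbar xc) :
  exists2 c0 : R, 0 < c0 &
  forall c, c0 <= c ->
  exists2 delta : R, 0 < delta &
  forall y0 : hprod (euclid R m) Z, ball ys delta y0 ->
    (forall (n : nat) (y : nat -> hprod (euclid R m) Z), y 0%N = y0 ->
       (forall k, (k < n)%N ->
          smm_step f h g K c (xc c) xs ys (eps c) (delta0 c) (y k) (y k.+1)) ->
       smm_step_well_defined f h g K c (xc c) xs ys (eps c) (delta0 c) (y n))
    /\
    (forall y : nat -> hprod (euclid R m) Z, y 0%N = y0 ->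
       (forall k,
          smm_step f h g K c (xc c) xs ys (eps c) (delta0 c) (y k) (y k.+1)) ->
       y @ \oo --> ys /\
       (fun k => y k.+1 - ys) =o_\oo (fun k => y k - ys)).
Proof.
(* Sufficiently large means c >= [cbar], where the data on [xc] and Assumption B are available. *)
exists cbar => // c cc; have c_gt0 : 0 < c by exact: lt_le_trans cc.
have P_ss z := (PiK_semismooth z).1.
have contraction := newton_contraction f_C2 h_C2 g_C2 K_self_dual P_ss c_gt0
  (xcP c cc) xs_stationary (asmB c cc).
have half0 : 0 < 2^-1 :> R by rewrite invr_gt0.
(* The factor 1/2 keeps all iterates in the ball where steps are well defined and makes the errors
   decay geometrically. *)
have [d d0 dP] := contraction _ half0; exists d => // y0 y0b.
have y0b' : `|y0 - ys| < d by move: y0b; rewrite -ball_normE/= distrC.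
have stay (y : nat -> hprod (euclid R m) Z) n : y 0%N = y0 ->
    (forall k, (k < n)%N -> smm_step f h g K c (xc c) xs ys (eps c) (delta0 c)
      (y k) (y k.+1)) ->
    ball ys d (y n) /\ `|y n - ys| <= 2^-1 ^+ n * `|y0 - ys|.
  move=> yy0; elim: n => [_|n ih ysteps]; first by rewrite yy0 expr0 mul1r.
  have [ynb yn] := ih (fun k kn => ysteps k (ltnW kn)).
  have yn1 := smm_step_contraction h_C2 g_C2 K_self_dual c_gt0 (xcP c cc)
    dP ynb (ysteps n (ltnSn n)).
  have yS : `|y n.+1 - ys| <= 2^-1 ^+ n.+1 * `|y0 - ys|.
    by rewrite (le_trans yn1)// exprS -mulrA ler_wpM2l// ltW.
  split=> //; rewrite -ball_normE/= distrC; apply: le_lt_trans yn1 _.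
  move: ynb; rewrite -ball_normE/= distrC; apply: le_lt_trans.
  by rewrite ler_piMl// invf_le1// ler1n.
split=> [n y yy0 ysteps|y yy0 ysteps].
  have [ynb _] := stay y n yy0 ysteps.
  apply: (smm_step_well_definedP f_C2 h_C2 g_C2 K_self_dual P_ss c_gt0
    (xcP c cc)); first exact: (dP _ ynb).1.
  by move=> W FW; exact: ((dP _ ynb).2 W FW).1.
have y_cvg : y @ \oo --> ys.
  apply/cvgrPdistC_le => e e0.
  have pow0 : (fun n => 2^-1 ^+ n * `|y0 - ys|) @ \oo --> (0 : R).
    rewrite -(mul0r `|y0 - ys|); apply: cvgMr_tmp; apply: cvg_expr.
    by rewrite ger0_norm ?(ltW half0)// invf_lt1// ltr1n.
  apply: filterS (near_dist pow0 e0) => n.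
  rewrite subr0 ger0_norm ?mulr_ge0 ?exprn_ge0 ?(ltW half0)//; apply: le_trans.
  by have [] := stay y n yy0 (fun k _ => ysteps k).
(* Since the iterates converge, they end up in the smaller ball on which the contraction factor is
   the prescribed [e]. *)
split=> //; apply/eqoP => e e0; have [d' d'0 d'P] := contraction _ e0.
have near_ball : \forall k \near \oo, ball ys d' (y k).
  exact: y_cvg _ (nbhsx_ballx _ _ d'0).
apply: filterS near_ball => k ykb /=.
exact: (smm_step_contraction h_C2 g_C2 K_self_dual c_gt0 (xcP c cc) d'P ykb
  (ysteps k)).
Qed.
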